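(* The only feasible group types for a $4$-GDD on at most $30$ points are $1^4$, $2^4$, $3^4$, $1^{13}$, $1^{9}4^1$, $2^7$, $3^5$, $1^{16}$, $1^{12} 4^1$, $1^{8} 4^2$, $1^{4} 4^3$, $4^4$, $2^6 5^1$, $2^{10}$, $5^4$, $3^5 6^1$, $1^{15} 7^1$, $2^9 5^1$, $3^8$, $3^4 6^2$, $6^4$, $1^{25}$, $1^{21} 4^1$, $1^{17} 4^2$, $1^{13}4^3$, $1^9 4^4$, $1^5 4^5$, $1^1 4^6$, $2^{13}$, $2^3 5^4$, $2^9 8^1$, $3^9$, $3^5 6^2$, $3^1 6^4$, $1^{28}$, $1^{24} 4^1$, $1^{20} 4^2$, $1^{16}4^3$, $1^{12} 4^4$, $1^8 4^5$, $1^4 4^6$, $4^7$, $1^{14} 7^2$, $1^{10} 4^1 7^2$, $1^6 4^2 7^2$, $1^2 4^3 7^2$, $7^4$, $2^{12} 5^1$, $2^2 5^5$, $2^8 5^1 8^1$, $3^8 6^1$, $3^4 6^3$, $6^5$, $3^7 9^1$. A $4$-GDD exists for every one of these types except for the types $2^4$, $2^6 5^1$ and $6^4$, for which no $4$-GDD exists.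
   Context: A group divisible design with block size $k$ ($k$-GDD) is a triple $(X,\mathcal{G},\mathcal{B})$ where $X$ is a finite set of points, $\mathcal{G}$ is a partition of $X$ into groups, and $\mathcal{B}$ is a collection of $k$-element subsets (blocks) of $X$ such that no block meets any group in more than one point and any two points from distinct groups lie together in exactly one block. The type of a GDD is the multiset of its group sizes; exponential notation $t_1^{u_1}\cdots t_m^{u_m}$ means $u_i$ groups of size $t_i$. A multiset $\{g_1,\dots,g_m\}$ of positive integers with $g_1\ge g_2\ge\cdots\ge g_m>0$ and $v=\sum_i g_i$ is called a feasible group type for a $4$-GDD if all of the following hold: (1) $m\ge 4$; (2) $v-g_i\equiv 0\pmod 3$ for all $i$; (3) $\sum_{i=1}^m g_i(v-g_i)\equiv 0\pmod 4$; (4) $3g_i+g_j\le v$ for all $i\ne j$; (5) if $m=4$ then all $g_i$ are equal; (6) if $m=5$ then the type is of the form $h^4n^1$ with $n\le 3h/2$; (7) if $3g_1+g_2=v$ and $g_1>g_2$ then $g_3\le 2g_1/3$; (8) if the type has the form $h_1^1 h_2^x h_3 h_4\cdots h_n$ where $3h_1+h_2=v$ and $h_2>h_3\ge h_4\ge\cdots\ge h_n>0$, then $n\ge 6$, and if moreover $n=6$ then $h_i(h_2-h_i)=h_j(h_2-h_j)$ for all $i,j\in\{3,4,5,6\}$. *)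

(* Defs.v *)
From mathcomp Require Import all_boot.

Set Implicit Arguments.
Unset Strict Implicit.
Unset Printing Implicit Defensive.

(* B may be taken to be a set: for k >= 2 a repeated block would contain two
   points of distinct groups, which would then lie together in two blocks. *)
Record is_gdd (k : nat) (X : finType) (G B : {set {set X}}) : Prop := IsGDD {
  gdd_groups : partition G [set: X];
  gdd_blocks : forall b, b \in B -> #|b| = k;
  gdd_transverse : forall b g, b \in B -> g \in G -> #|b :&: g| <= 1;
  gdd_pairs : forall g h x y, g \in G -> h \in G -> g != h ->
    x \in g -> y \in h -> #|[set b in B | (x \in b) && (y \in b)]| = 1
}.

Definition group_sizes (X : finType) (G : {set {set X}}) : seq nat :=
  [seq #|g : {set X}| | g <- enum G].

(* The finite multiset of group sizes is compared with s up to perm_eq. *)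
Definition gdd_exists (k : nat) (s : seq nat) : Prop :=
  exists (X : finType) (G B : {set {set X}}),
    is_gdd k G B /\ perm_eq (group_sizes G) s.

(* A multiset of positive integers is represented by its nonincreasing
   enumeration s = [:: g_1; ...; g_m], so that g_i is nth 0 s i.-1 and
   v is sumn s.
   In feasible8, hs = [:: h_3; ...; h_n], so that n = size hs + 2; writing the
   type as h_1^1 h_2^x h_3 ... h_n presupposes x >= 1 and n >= 3. *)
Record feasible_4gdd_type (s : seq nat) : Prop := Feasible4GDDType {
  feasible_sorted : sorted geq s;
  feasible_pos : all (fun g => 0 < g) s;
  feasible1 : 4 <= size s;
  feasible2 : forall g, g \in s -> 3 %| sumn s - g;
  feasible3 : 4 %| \sum_(g <- s) g * (sumn s - g);
  feasible4 : forall i j, i < size s -> j < size s -> i != j ->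
    3 * nth 0 s i + nth 0 s j <= sumn s;
  feasible5 : size s = 4 -> forall g h, g \in s -> h \in s -> g = h;
  feasible6 : size s = 5 ->
    exists h n, perm_eq s (n :: nseq 4 h) /\ 2 * n <= 3 * h;
  feasible7 : 3 * nth 0 s 0 + nth 0 s 1 = sumn s -> nth 0 s 1 < nth 0 s 0 ->
    3 * nth 0 s 2 <= 2 * nth 0 s 0;
  feasible8 : forall (h1 h2 x : nat) (hs : seq nat),
    perm_eq s (h1 :: nseq x h2 ++ hs) ->
    0 < x -> 0 < size hs ->
    3 * h1 + h2 = sumn s ->
    sorted geq hs -> all (fun h => 0 < h < h2) hs ->
    6 <= size hs + 2 /\
    (size hs + 2 = 6 -> forall a b, a \in hs -> b \in hs ->
       a * (h2 - a) = b * (h2 - b))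
}.

(* [:: (t_1, u_1); ...; (t_r, u_r)] stands for t_1^u_1 ... t_r^u_r. *)
Definition expo_type (e : seq (nat * nat)) : seq nat :=
  sort geq (tally_seq e).

Definition listed_types : seq (seq nat) := map expo_type [::
  [:: (1, 4)]; [:: (2, 4)]; [:: (3, 4)];
  [:: (1, 13)]; [:: (1, 9); (4, 1)]; [:: (2, 7)];
  [:: (3, 5)]; [:: (1, 16)]; [:: (1, 12); (4, 1)];
  [:: (1, 8); (4, 2)]; [:: (1, 4); (4, 3)]; [:: (4, 4)];
  [:: (2, 6); (5, 1)]; [:: (2, 10)]; [:: (5, 4)];
  [:: (3, 5); (6, 1)]; [:: (1, 15); (7, 1)]; [:: (2, 9); (5, 1)];
  [:: (3, 8)]; [:: (3, 4); (6, 2)]; [:: (6, 4)];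
  [:: (1, 25)]; [:: (1, 21); (4, 1)]; [:: (1, 17); (4, 2)];
  [:: (1, 13); (4, 3)]; [:: (1, 9); (4, 4)]; [:: (1, 5); (4, 5)];
  [:: (1, 1); (4, 6)]; [:: (2, 13)]; [:: (2, 3); (5, 4)];
  [:: (2, 9); (8, 1)]; [:: (3, 9)]; [:: (3, 5); (6, 2)];
  [:: (3, 1); (6, 4)]; [:: (1, 28)]; [:: (1, 24); (4, 1)];
  [:: (1, 20); (4, 2)]; [:: (1, 16); (4, 3)]; [:: (1, 12); (4, 4)];
  [:: (1, 8); (4, 5)]; [:: (1, 4); (4, 6)]; [:: (4, 7)];
  [:: (1, 14); (7, 2)]; [:: (1, 10); (4, 1); (7, 2)]; [:: (1, 6); (4, 2); (7, 2)];
  [:: (1, 2); (4, 3); (7, 2)]; [:: (7, 4)]; [:: (2, 12); (5, 1)];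
  [:: (2, 2); (5, 5)]; [:: (2, 8); (5, 1); (8, 1)]; [:: (3, 8); (6, 1)];
  [:: (3, 4); (6, 3)]; [:: (6, 5)]; [:: (3, 7); (9, 1)]
].

Definition exceptional_types : seq (seq nat) := map expo_type [::
  [:: (2, 4)]; [:: (2, 6); (5, 1)]; [:: (6, 4)]
].

(* Main.v *)
Require Import Defs.
From mathcomp Require Import all_boot all_algebra zify.

Set Implicit Arguments.
Unset Strict Implicit.
Unset Printing Implicit Defensive.

Import GRing.Theory.

(** All group sizes are congruent to the number of points modulo 3, so that the
    feasible types on at most 30 points are found among few candidates, and
    existence is witnessed by explicit designs, filling a group of size 4 with a
    block whenever that suffices.

    In a 4-GDD of type 2^6 5^1 every block meets the group of size 5. The five
    blocks through a point outside it and the groups of size 2 induce two perfect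
    matchings on ten points, whose union is a 10-cycle or a 4-cycle plus a
    6-cycle; either case leaves a small exhaustive search.

    Type 6^4 follows Stinson's proof that there are no two orthogonal Latin
    squares of order 6. The 24 x 36 point-block incidence matrix A over F_2 has
    rank (A A^T) <= 4, hence rank A <= 20, which forces a set of points S, not a
    union of groups, that meets every block in an even number of points. Counting
    shows that a smallest such S has two points in each group and meets each block
    in 0 or 2 points. Naming the other points by the blocks through two points of
    S leaves again a small exhaustive search. *)

(** * Feasible types *)

(** Some clauses of feasibility quantify over all naturals or all sequences, so feasibility is
    reflected into a boolean that can be evaluated on the candidates. In the nonexistence proofs the
    obstacle is symmetry: a backtracking search over unnamed points would meet every relabelling of
    each partial design. The structural arguments serve to give the points canonical numbers. What
    every block must satisfy under this numbering then becomes a boolean filter on bit sequences,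
    and one search procedure, proved sound once, treats both large types by evaluation. *)

Definition feasible6b (s : seq nat) : bool :=
  has (fun n => let r := rem n s in
    all (pred1 (head 0 r)) r && (2 * n <= 3 * head 0 r)) s.

(** In a decomposition as in condition (8), [h1] and [h2] determine the rest: once [h1] is removed
    no entry exceeds [h2], [x] is the multiplicity of [h2], and [hs] consists of the smaller
    entries. Two quantifiers over the entries of [s] therefore replace the unbounded ones. *)
Definition feasible8b (s : seq nat) : bool :=
  all (fun h1 => let r := rem h1 s in
    all (fun h2 => let hs := [seq h <- r | h < h2] in
      [&& 3 * h1 + h2 == sumn s, all (geq h2) r & 0 < size hs] ==>
      (6 <= size hs + 2) && ((size hs + 2 == 6) ==>
         all (fun a => all (fun b => a * (h2 - a) == b * (h2 - b)) hs) hs)) r) s.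

Definition feasibleb (s : seq nat) : bool :=
  let v := sumn s in
  [&& sorted geq s, all (leq 1) s, 4 <= size s,
      all (fun g => 3 %| v - g) s,
      4 %| sumn [seq g * (v - g) | g <- s],
      all (fun i => all (fun j => (i != j) ==> (3 * nth 0 s i + nth 0 s j <= v))
        (iota 0 (size s))) (iota 0 (size s)),
      (size s == 4) ==> all (fun g => all (eq_op g) s) s,
      (size s == 5) ==> feasible6b s,
      (3 * nth 0 s 0 + nth 0 s 1 == v) ==> (nth 0 s 1 < nth 0 s 0) ==>
        (3 * nth 0 s 2 <= 2 * nth 0 s 0) &
      feasible8b s].

Lemma all_iotaP (n : nat) (P : pred nat) :
  reflect (forall i, i < n -> P i) (all P (iota 0 n)).
Proof.
by apply: (iffP allP) => h i; [move=> lin; apply: h | move=> ini; apply: h];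
  move: (mem_iota 0 n i); rewrite add0n /= => e; rewrite -?e // e.
Qed.

Lemma feasible6P (s : seq nat) : size s = 5 ->
  reflect (exists h n, perm_eq s (n :: nseq 4 h) /\ 2 * n <= 3 * h)
    (feasible6b s).
Proof.
move=> sz; apply: (iffP hasP) => [[n ns /= /andP[rE le]]|[h [n [sE le]]]].
  exists (head 0 (rem n s)), n; split=> //.
  apply: perm_trans (perm_to_rem ns) _; rewrite perm_cons.
  by move/all_pred1P: rE => rE; rewrite {1}rE size_rem // sz.
have ns : n \in s by rewrite (perm_mem sE) mem_head.
have rE : perm_eq (rem n s) (nseq 4 h).
  by rewrite -(perm_cons n) -(permPl (perm_to_rem ns)).
have rE' : rem n s = nseq 4 h.
  have /all_pred1P -> : all (pred1 h) (rem n s).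
    by rewrite (perm_all _ rE) all_nseq /= eqxx.
  by rewrite (perm_size rE) size_nseq.
by exists n => //=; rewrite rE' /= eqxx.
Qed.

Lemma feasible8P (s : seq nat) : all (leq 1) s ->
  reflect (forall (h1 h2 x : nat) (hs : seq nat),
    perm_eq s (h1 :: nseq x h2 ++ hs) ->
    0 < x -> 0 < size hs ->
    3 * h1 + h2 = sumn s ->
    sorted geq hs -> all (fun h => 0 < h < h2) hs ->
    6 <= size hs + 2 /\
    (size hs + 2 = 6 -> forall a b, a \in hs -> b \in hs ->
       a * (h2 - a) = b * (h2 - b))) (feasible8b s).
Proof.
move=> s_gt0; apply: (iffP allP) => [fs h1 h2 x hs sE x_gt0 hs_gt0 vE _ hsP|fs h1 h1s].
  have h1s : h1 \in s by rewrite (perm_mem sE) mem_head.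
  have rE : perm_eq (rem h1 s) (nseq x h2 ++ hs).
    by rewrite -(perm_cons h1) -(permPl (perm_to_rem h1s)).
  have h2r : h2 \in rem h1 s by rewrite (perm_mem rE) mem_cat mem_nseq x_gt0 eqxx.
  have fE : perm_eq [seq h <- rem h1 s | h < h2] hs.
    rewrite (permPl (perm_filter _ rE)) filter_cat filter_nseq ltnn /=.
    have -> // : [seq h <- hs | h < h2] = hs.
    by apply/all_filterP; apply: sub_all hsP => h /andP[].
  have /allP/(_ _ h2r)/implyP := fs _ h1s.
  rewrite vE eqxx (perm_all _ rE) all_cat all_nseq (perm_size fE) hs_gt0 /= leqnn orbT.
  have -> : all (geq h2) hs by apply: sub_all hsP => h /andP[_ /ltnW].
  move=> /(_ isT)/andP[-> /implyP fs6]; split=> // sz a b ah bh.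
  have := fs6; rewrite sz eqxx => /(_ isT).
  rewrite (perm_all _ fE) => /allP/(_ _ ah).
  by rewrite (perm_all _ fE) => /allP/(_ _ bh)/eqP.
apply/allP => h2 h2r; apply/implyP => /and3P[/eqP vE rle hs_gt0].
set hs := [seq h <- _ | _] in hs_gt0 *.
(* The decomposition fed to the hypothesis: the copies of [h2], then the smaller entries, sorted
   because condition (8) asks for a nonincreasing [hs]. *)
have rE : perm_eq (rem h1 s) (nseq (count_mem h2 (rem h1 s)) h2 ++ sort geq hs).
  rewrite -(permPl (permEl (perm_filterC (pred1 h2) _))).
  have /all_pred1P -> := filter_all (pred1 h2) (rem h1 s).
  rewrite size_filter perm_cat2l perm_sym perm_sort /hs.
  rewrite (@eq_in_filter _ (fun h => h < h2) (predC (pred1 h2))) // => h hr.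
  by have := allP rle _ hr; rewrite /= ltn_neqAle => ->; rewrite andbT.
have [] := fs h1 h2 (count_mem h2 (rem h1 s)) (sort geq hs) _ _ _ vE.
- by rewrite (permPl (perm_to_rem h1s)) perm_cons.
- by rewrite -has_count; apply/hasP; exists h2 => /=.
- by rewrite size_sort.
- by apply: sort_sorted => i j; apply: leq_total.
- rewrite all_sort; apply/allP => h; rewrite mem_filter => /andP[-> hr].
  by rewrite andbT; apply: (allP s_gt0); apply: mem_rem hr.
rewrite size_sort => -> fs6; apply/implyP => /eqP sz.
by apply/allP => a ah; apply/allP => b bh; apply/eqP; apply: fs6; rewrite ?mem_sort.
Qed.

Lemma feasibleP (s : seq nat) : reflect (feasible_4gdd_type s) (feasibleb s).
Proof.
apply: (iffP idP) => [/and5P[h0 h1 h2 h3 /and5P[h4 h5 h6 h7 /andP[h8 h9]]]|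
    [h0 h1 h2 h3 h4 h5 h6 h7 h8 h9]].
  split=> //.
  - by move=> g gs; apply: (allP h3).
  - by move: h4; rewrite sumnE big_map.
  - move=> i j si sj; apply/implyP.
    by have /all_iotaP/(_ _ si)/all_iotaP/(_ _ sj) := h5.
  - move=> /eqP sz g h gs hs; move: h6; rewrite sz => /allP/(_ _ gs)/allP/(_ _ hs).
    by move/eqP.
  - by move=> sz; apply/feasible6P => //; move: h7; rewrite sz.
  - by move=> /eqP e1 e2; move: h8; rewrite e1 e2.
  - exact/feasible8P.
apply/and5P; split=> //; first exact/allP.
apply/and5P; split=> //.
- by rewrite sumnE big_map.
- apply/all_iotaP => i si; apply/all_iotaP => j sj; apply/implyP; exact: h5.
- by apply/implyP => /eqP sz; apply/allP => g gs; apply/allP => h hs; apply/eqP; apply: h6.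
- by apply/implyP => /eqP sz; apply/feasible6P => //; apply: h7.
- by apply/andP; split; [apply/implyP => /eqP e; apply/implyP; apply: h8 | apply/feasible8P].
Qed.

(** Here [n] is fuel, [r] the residue modulo 3 shared by all entries, [m] a bound on the next entry
    and [v] the sum still to be reached. *)
Fixpoint nonincr_seqs (n r m v : nat) : seq (seq nat) :=
  if v == 0 then [:: [::]] else
  if n is n'.+1 then
    flatten [seq [seq k :: t | t <- nonincr_seqs n' r k (v - k)]
      | k <- iota 1 (minn m v) & k %% 3 == r]
  else [::].

Lemma mem_nonincr_seqs (r : nat) (s : seq nat) (n m : nat) : sumn s <= n ->
  path geq m s -> all (leq 1) s -> all (fun g => g %% 3 == r) s ->
  s \in nonincr_seqs n r m (sumn s).
Proof.
elim: s n m => [|k t IH] [|n] m //=.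
  by rewrite leqn0 addn_eq0 => /andP[/eqP->].
move=> le /andP[km pt] /andP[k1 t1] /andP[kr tr].
rewrite addn_eq0 [k == 0]eqn0Ngt k1 /=.
apply/flatten_mapP; exists k.
  by rewrite mem_filter kr mem_iota k1 add1n ltnS leq_min [k <= m]km leq_addr.
rewrite addKn; apply: map_f; apply: IH => //.
(* A positive entry lowers the sum by at least one, so one unit of fuel per entry is enough. *)
move: le k1; case: (k) => // j; rewrite addSn ltnS => le _.
by apply: leq_trans le; rewrite leq_addl.
Qed.

Lemma listed_enumeration :
  all (fun v => all (fun s => feasibleb s ==> (s \in listed_types))
    (nonincr_seqs v (v %% 3) v v)) (iota 0 31).
Proof. by vm_compute. Qed.

Lemma listed_feasible :
  all (fun s => feasibleb s && (sumn s <= 30)) listed_types.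
Proof. by vm_compute. Qed.

Lemma feasible_listed (s : seq nat) :
  feasible_4gdd_type s /\ sumn s <= 30 <-> s \in listed_types.
Proof.
split=> [[fs le]|sl]; last first.
  by have /andP[/feasibleP] := allP listed_feasible _ sl.
have /all_iotaP/(_ (sumn s) le)/allP := listed_enumeration.
move=> /(_ s) h; apply: (implyP (h _)); last exact/feasibleP.
have gle g : g \in s -> g <= sumn s.
  by move=> gs; rewrite (perm_sumn (perm_to_rem gs)) leq_addr.
apply: mem_nonincr_seqs => //.
- have := feasible_sorted fs; case: (s) gle => //= g t gle ->.
  by rewrite /geq /= gle ?mem_head.
- exact: feasible_pos fs.
apply/allP => g gs; rewrite eq_sym eqn_mod_dvd ?gle //.
exact: feasible2 fs _ gs.
Qed.

(** * Existence *)

(** Entry [x] is the index of the group containing the point [x]; the groups are consecutive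
    intervals of points. *)
Definition group_labels (s : seq nat) : seq nat :=
  flatten [seq nseq (nth 0 s j) j | j <- iota 0 (size s)].

(** That the labels along a block are distinct says both that its entries are distinct and that no
    two share a group. The blocks through [x] are filtered before [y] varies, which keeps the check
    of all pairs cheap. *)
Definition gdd_check (k : nat) (s : seq nat) (bs : seq (seq nat)) : bool :=
  let l := group_labels s in
  [&& all (leq 1) s, size l == sumn s,
      all (gtn (size s)) l,
      all (fun j => count_mem j l == nth 0 s j) (iota 0 (size s)),
      all (fun b => [&& size b == k, all (gtn (sumn s)) b &
        uniq [seq nth 0 l x | x <- b]]) bs &
      all (fun x => let bx := [seq b <- bs | x \in b] in
        all (fun y => (nth 0 l x != nth 0 l y) ==>
          (count (fun b : seq nat => y \in b) bx == 1)) (iota 0 (sumn s)))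
        (iota 0 (sumn s))].

(** * Soundness of the check of explicit designs *)

Section Soundness.

Variables (k : nat) (s : seq nat) (bs : seq (seq nat)).
Hypothesis s_bs : gdd_check k s bs.

Let l := group_labels s.
Let v := sumn s.
Let points (b : seq nat) : {set 'I_v} := [set x : 'I_v | val x \in b].
Let cell (j : 'I_(size s)) : {set 'I_v} := [set x : 'I_v | nth 0 l x == j].
Let G := [set cell j | j in 'I_(size s)].
Let B := [set:: [seq points b | b <- bs]].

Let card_cell j : #|cell j| = nth 0 s j.
Proof.
case/and5P: s_bs => _ /eqP sz _ lc _.
have /allP/(_ (val j)) := lc; rewrite mem_iota ltn_ord => /(_ isT)/eqP <-.
rewrite cardsE cardE size_filter.
rewrite (eq_count (a2 := preim val (fun i => nth 0 l i == j))) //.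
rewrite -count_map -enumT val_enum_ord -(count_map (nth 0 l) (pred1 (val j))).
by rewrite -[v]sz map_nth_iota0 ?take_size.
Qed.

Let label_lt (x : 'I_v) : nth 0 l x < size s.
Proof.
case/and5P: s_bs => _ /eqP sz /allP ll _ _.
by apply: ll; rewrite mem_nth // /l sz.
Qed.

Let in_cell x j : (x \in cell j) = (nth 0 l x == j).
Proof. by rewrite inE. Qed.

Let cell_inj : injective cell.
Proof.
move=> i j ij; case/and5P: s_bs => sp _ _ _ _.
have : 0 < #|cell i| by rewrite card_cell; apply: (allP sp); rewrite mem_nth.
case/card_gt0P => x xi; apply: val_inj; have := xi; rewrite ij.
by move: xi; rewrite !in_cell => /eqP e /eqP; rewrite e.
Qed.

Lemma gdd_check_is_gdd : is_gdd k G B.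
Proof.
case/and5P: (s_bs) => sp /eqP sz ll _ /andP[bP /allP pP].
have inB (b : {set 'I_v}) : b \in B -> exists2 b', b' \in bs & b = points b'.
  by rewrite inE => /mapP.
have inG (g : {set 'I_v}) : g \in G -> exists j, g = cell j.
  by case/imsetP => j _ ->; exists j.
split.
- apply/and3P; split.
  + rewrite eqEsubset subsetT; apply/subsetP => x _; apply/bigcupP.
    by exists (cell (Ordinal (label_lt x))); rewrite ?imset_f // in_cell.
  + apply/trivIsetP => _ _ /inG[i ->] /inG[j ->] ij.
    rewrite -setI_eq0; apply/eqP/setP => x; rewrite inE !in_cell inE.
    by apply: contraNF ij => /andP[/eqP e /eqP]; rewrite e => /val_inj ->.
  + apply/negP => /inG[j /eqP]; rewrite eq_sym -cards_eq0 card_cell => /eqP e0.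
    by have := allP sp _ (mem_nth 0 (ltn_ord j)); rewrite e0.
- move=> _ /inB[b bb ->]; have /and3P[/eqP <- /allP bv /map_uniq bu] := allP bP _ bb.
  (* All entries are below [v], so lifting the list to ['I_v] loses none of them. *)
  have bE : map val (pmap insub b : seq 'I_v) = b.
    rewrite pmap_filter; last exact: insubK.
    by apply/all_filterP/allP => x /bv /= xv; rewrite isSome_insub.
  rewrite -[in RHS]bE size_map -(card_uniqP _); last by rewrite pmap_sub_uniq.
  by apply: eq_card => x; rewrite inE -[in LHS]bE (mem_map val_inj).
- move=> _ _ /inB[b bb ->] /inG[j ->]; have /and3P[_ _ bu] := allP bP _ bb.
  rewrite leqNgt; apply/negP => /card_gt1P[x [y [xb yb /negP]]]; apply.
  move: xb yb; rewrite !inE => /andP[xb /eqP xj] /andP[yb /eqP yj].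
  have ixy : index (val x) b = index (val y) b.
    apply/eqP; rewrite -(nth_uniq 0 _ _ bu) ?size_map ?index_mem //.
    by rewrite !(nth_map 0) ?index_mem // !nth_index // -/l xj yj.
  by apply/eqP/val_inj; rewrite -(nth_index 0 xb) ixy nth_index.
- move=> _ _ x y /inG[i ->] /inG[j ->] ij; rewrite !in_cell => /eqP xi /eqP yj.
  have := pP (val x); rewrite mem_iota ltn_ord => /(_ isT)/allP/(_ (val y)).
  rewrite mem_iota ltn_ord -/l xi yj => /(_ isT)/implyP.
  have ij' : val i != val j by apply: contraNneq ij => /val_inj ->.
  move=> /(_ ij'); rewrite -size_filter.
  case fE: [seq b <- _ | _] => [|b0 [|//]] // _.
  (* The check leaves a single list [b0] through both points, so its image is the only such
     block. *)
  have inf b : (b \in bs) && (val x \in b) && (val y \in b) = (b == b0).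
    by rewrite -mem_seq1 -fE !mem_filter andbC [(b \in bs) && _]andbC.
  apply/eqP/cards1P; exists (points b0); apply/setP => b; rewrite inE in_set1.
  have := inf b0; rewrite eqxx => /andP[/andP[b0s xb0] yb0].
  apply/idP/eqP => [/and3P[/inB[b' b's ->]]|->].
    by rewrite !inE => xb yb; have := inf b'; rewrite b's xb yb => /esym/eqP ->.
  by rewrite !inE xb0 yb0 map_f.
Qed.

Lemma gdd_check_sizes : perm_eq (group_sizes G) s.
Proof.
have GE : perm_eq (enum G) (map cell (enum 'I_(size s))).
  apply: uniq_perm; rewrite ?enum_uniq ?(map_inj_uniq cell_inj) ?enum_uniq //.
  move=> g; rewrite mem_enum; apply/imsetP/mapP => -[j _ ->]; exists j => //.
  by rewrite mem_enum.
rewrite /group_sizes (permPl (perm_map _ GE)) -map_comp.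
rewrite (eq_map (g := nth 0 s \o val)); last by move=> j /=; rewrite card_cell.
by rewrite map_comp val_enum_ord map_nth_iota0 // take_size.
Qed.

Lemma gdd_check_sound : gdd_exists k s.
Proof. by exists 'I_v, G, B; split; [exact: gdd_check_is_gdd | exact: gdd_check_sizes]. Qed.

End Soundness.

Fixpoint quads (l : seq nat) : seq (seq nat) :=
  if l is a :: b :: c :: d :: l' then [:: a; b; c; d] :: quads l' else [::].

(* blocks_txu_... is a 4-GDD of type t^u ..., found by computer search with a
   prescribed automorphism group. Its points are numbered group by group, the
   largest groups first. *)
Definition blocks_1x4 : seq (seq nat) := quads [::
  0; 1; 2; 3].

Definition blocks_3x4 : seq (seq nat) := quads [::
  0; 3; 8; 11; 0; 4; 6; 9; 0; 5; 7; 10; 1; 3; 7; 9; 1; 4; 8; 10;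
  1; 5; 6; 11; 2; 3; 6; 10; 2; 4; 7; 11; 2; 5; 8; 9].

Definition blocks_1x9_4x1 : seq (seq nat) := quads [::
  0; 4; 7; 10; 0; 5; 6; 12; 0; 8; 9; 11; 1; 4; 9; 12; 1; 5; 8; 10;
  1; 6; 7; 11; 2; 4; 5; 11; 2; 6; 9; 10; 2; 7; 8; 12; 3; 4; 6; 8;
  3; 5; 7; 9; 3; 10; 11; 12].

Definition blocks_2x7 : seq (seq nat) := quads [::
  0; 2; 8; 13; 0; 3; 7; 10; 0; 4; 11; 12; 0; 5; 6; 9; 1; 2; 6; 11;
  1; 3; 9; 12; 1; 4; 7; 8; 1; 5; 10; 13; 2; 4; 9; 10; 2; 5; 7; 12;
  3; 4; 6; 13; 3; 5; 8; 11; 6; 8; 10; 12; 7; 9; 11; 13].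

Definition blocks_3x5 : seq (seq nat) := quads [::
  0; 3; 6; 10; 0; 4; 8; 13; 0; 5; 9; 14; 0; 7; 11; 12; 1; 3; 11; 13;
  1; 4; 7; 9; 1; 5; 6; 12; 1; 8; 10; 14; 2; 3; 7; 14; 2; 4; 10; 12;
  2; 5; 8; 11; 2; 6; 9; 13; 3; 8; 9; 12; 4; 6; 11; 14; 5; 7; 10; 13].

Definition blocks_4x4 : seq (seq nat) := quads [::
  0; 4; 11; 13; 0; 5; 9; 14; 0; 6; 8; 12; 0; 7; 10; 15; 1; 4; 10; 12;
  1; 5; 8; 15; 1; 6; 9; 13; 1; 7; 11; 14; 2; 4; 8; 14; 2; 5; 10; 13;
  2; 6; 11; 15; 2; 7; 9; 12; 3; 4; 9; 15; 3; 5; 11; 12; 3; 6; 10; 14;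
  3; 7; 8; 13].

Definition blocks_2x10 : seq (seq nat) := quads [::
  0; 2; 6; 15; 0; 3; 8; 11; 0; 4; 10; 19; 0; 5; 12; 14; 0; 7; 17; 18;
  0; 9; 13; 16; 1; 2; 12; 16; 1; 3; 7; 15; 1; 4; 6; 9; 1; 5; 11; 19;
  1; 8; 14; 18; 1; 10; 13; 17; 2; 4; 8; 17; 2; 5; 7; 10; 2; 9; 14; 19;
  2; 11; 13; 18; 3; 4; 12; 18; 3; 5; 9; 17; 3; 6; 13; 19; 3; 10; 14; 16;
  4; 7; 13; 14; 4; 11; 15; 16; 5; 6; 16; 18; 5; 8; 13; 15; 6; 8; 10; 12;
  6; 11; 14; 17; 7; 8; 16; 19; 7; 9; 11; 12; 9; 10; 15; 18; 12; 15; 17; 19].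

Definition blocks_5x4 : seq (seq nat) := quads [::
  0; 5; 12; 17; 0; 6; 11; 15; 0; 7; 10; 18; 0; 8; 14; 16; 0; 9; 13; 19;
  1; 5; 10; 16; 1; 6; 14; 19; 1; 7; 13; 17; 1; 8; 12; 15; 1; 9; 11; 18;
  2; 5; 13; 15; 2; 6; 12; 18; 2; 7; 11; 16; 2; 8; 10; 19; 2; 9; 14; 17;
  3; 5; 11; 19; 3; 6; 10; 17; 3; 7; 14; 15; 3; 8; 13; 18; 3; 9; 12; 16;
  4; 5; 14; 18; 4; 6; 13; 16; 4; 7; 12; 19; 4; 8; 11; 17; 4; 9; 10; 15].

Definition blocks_3x5_6x1 : seq (seq nat) := quads [::
  0; 6; 9; 19; 0; 7; 12; 16; 0; 8; 10; 20; 0; 11; 14; 15; 0; 13; 17; 18;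
  1; 6; 14; 17; 1; 7; 10; 15; 1; 8; 16; 19; 1; 9; 12; 18; 1; 11; 13; 20;
  2; 6; 10; 13; 2; 7; 11; 18; 2; 8; 9; 17; 2; 12; 15; 19; 2; 14; 16; 20;
  3; 6; 15; 18; 3; 7; 17; 20; 3; 8; 11; 12; 3; 9; 13; 16; 3; 10; 14; 19;
  4; 6; 12; 20; 4; 7; 9; 14; 4; 8; 13; 15; 4; 10; 16; 18; 4; 11; 17; 19;
  5; 6; 11; 16; 5; 7; 13; 19; 5; 8; 14; 18; 5; 9; 15; 20; 5; 10; 12; 17].

Definition blocks_1x15_7x1 : seq (seq nat) := quads [::
  0; 7; 14; 19; 0; 8; 15; 20; 0; 9; 16; 17; 0; 10; 13; 18; 0; 11; 12; 21;
  1; 7; 12; 13; 1; 8; 16; 21; 1; 9; 10; 19; 1; 11; 17; 20; 1; 14; 15; 18;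
  2; 7; 10; 20; 2; 8; 11; 14; 2; 9; 13; 21; 2; 12; 17; 18; 2; 15; 16; 19;
  3; 7; 8; 17; 3; 9; 12; 15; 3; 10; 14; 21; 3; 11; 18; 19; 3; 13; 16; 20;
  4; 7; 15; 21; 4; 8; 9; 18; 4; 10; 11; 16; 4; 12; 19; 20; 4; 13; 14; 17;
  5; 7; 16; 18; 5; 8; 10; 12; 5; 9; 14; 20; 5; 11; 13; 15; 5; 17; 19; 21;
  6; 7; 9; 11; 6; 8; 13; 19; 6; 10; 15; 17; 6; 12; 14; 16; 6; 18; 20; 21].

Definition blocks_2x9_5x1 : seq (seq nat) := quads [::
  0; 5; 15; 17; 0; 6; 8; 19; 0; 7; 10; 22; 0; 9; 11; 18; 0; 12; 14; 20;
  0; 13; 16; 21; 1; 5; 7; 19; 1; 6; 15; 18; 1; 8; 10; 21; 1; 9; 12; 17;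
  1; 11; 13; 20; 1; 14; 16; 22; 2; 5; 8; 20; 2; 6; 16; 17; 2; 7; 9; 21;
  2; 10; 12; 18; 2; 11; 14; 19; 2; 13; 15; 22; 3; 5; 9; 13; 3; 6; 11; 21;
  3; 7; 14; 17; 3; 8; 12; 16; 3; 10; 15; 20; 3; 18; 19; 22; 4; 5; 12; 22;
  4; 6; 10; 14; 4; 7; 11; 15; 4; 8; 13; 18; 4; 9; 16; 19; 4; 17; 20; 21;
  5; 10; 11; 16; 5; 14; 18; 21; 6; 7; 12; 13; 6; 9; 20; 22; 7; 16; 18; 20;
  8; 9; 14; 15; 8; 11; 17; 22; 10; 13; 17; 19; 12; 15; 19; 21].

Definition blocks_3x8 : seq (seq nat) := quads [::
  0; 3; 13; 15; 0; 4; 8; 23; 0; 5; 17; 20; 0; 6; 9; 19; 0; 7; 14; 21;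
  0; 10; 12; 18; 0; 11; 16; 22; 1; 3; 9; 12; 1; 4; 14; 16; 1; 5; 18; 23;
  1; 6; 17; 22; 1; 7; 10; 20; 1; 8; 15; 21; 1; 11; 13; 19; 2; 3; 8; 20;
  2; 4; 10; 13; 2; 5; 6; 11; 2; 7; 12; 22; 2; 9; 16; 21; 2; 14; 17; 18;
  2; 15; 19; 23; 3; 6; 16; 18; 3; 7; 11; 23; 3; 10; 17; 21; 3; 14; 19; 22;
  4; 6; 12; 15; 4; 7; 17; 19; 4; 9; 20; 22; 4; 11; 18; 21; 5; 7; 13; 16;
  5; 8; 9; 14; 5; 10; 15; 22; 5; 12; 19; 21; 6; 10; 14; 23; 6; 13; 20; 21;
  7; 9; 15; 18; 8; 10; 16; 19; 8; 11; 12; 17; 8; 13; 18; 22; 9; 13; 17; 23;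
  11; 14; 15; 20; 12; 16; 20; 23].

Definition blocks_3x4_6x2 : seq (seq nat) := quads [::
  0; 6; 19; 21; 0; 7; 12; 23; 0; 8; 17; 22; 0; 9; 14; 20; 0; 10; 13; 16;
  0; 11; 15; 18; 1; 6; 20; 23; 1; 7; 13; 22; 1; 8; 15; 21; 1; 9; 12; 18;
  1; 10; 14; 17; 1; 11; 16; 19; 2; 6; 18; 22; 2; 7; 14; 21; 2; 8; 16; 23;
  2; 9; 13; 19; 2; 10; 12; 15; 2; 11; 17; 20; 3; 6; 13; 15; 3; 7; 16; 18;
  3; 8; 12; 19; 3; 9; 17; 21; 3; 10; 20; 22; 3; 11; 14; 23; 4; 6; 12; 17;
  4; 7; 15; 20; 4; 8; 14; 18; 4; 9; 16; 22; 4; 10; 19; 23; 4; 11; 13; 21;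
  5; 6; 14; 16; 5; 7; 17; 19; 5; 8; 13; 20; 5; 9; 15; 23; 5; 10; 18; 21;
  5; 11; 12; 22; 12; 16; 20; 21; 13; 17; 18; 23; 14; 15; 19; 22].

Definition blocks_1x1_4x6 : seq (seq nat) := quads [::
  0; 4; 11; 15; 0; 5; 16; 20; 0; 6; 12; 21; 0; 7; 8; 23; 0; 9; 13; 18;
  0; 10; 19; 22; 0; 14; 17; 24; 1; 4; 17; 22; 1; 5; 9; 24; 1; 6; 10; 14;
  1; 7; 13; 20; 1; 8; 12; 16; 1; 11; 18; 23; 1; 15; 19; 21; 2; 4; 14; 23;
  2; 5; 10; 18; 2; 6; 9; 22; 2; 7; 15; 16; 2; 8; 17; 20; 2; 11; 13; 21;
  2; 12; 19; 24; 3; 4; 8; 19; 3; 5; 15; 22; 3; 6; 13; 17; 3; 7; 11; 24;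
  3; 9; 16; 21; 3; 10; 12; 23; 3; 14; 18; 20; 4; 9; 12; 20; 4; 10; 13; 16;
  4; 18; 21; 24; 5; 8; 14; 21; 5; 11; 12; 17; 5; 13; 19; 23; 6; 8; 15; 18;
  6; 11; 19; 20; 6; 16; 23; 24; 7; 9; 14; 19; 7; 10; 17; 21; 7; 12; 18; 22;
  8; 13; 22; 24; 9; 15; 17; 23; 10; 15; 20; 24; 11; 14; 16; 22].

Definition blocks_2x13 : seq (seq nat) := quads [::
  0; 2; 10; 25; 0; 3; 17; 18; 0; 4; 12; 16; 0; 5; 11; 13; 0; 6; 8; 24;
  0; 7; 19; 21; 0; 9; 15; 23; 0; 14; 20; 22; 1; 2; 13; 23; 1; 3; 5; 7;
  1; 4; 10; 17; 1; 6; 15; 16; 1; 8; 12; 18; 1; 9; 11; 22; 1; 14; 21; 24;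
  1; 19; 20; 25; 2; 4; 9; 24; 2; 5; 12; 19; 2; 6; 14; 18; 2; 7; 8; 15;
  2; 11; 17; 20; 2; 16; 21; 22; 3; 4; 15; 20; 3; 6; 9; 19; 3; 8; 11; 21;
  3; 10; 12; 14; 3; 13; 22; 24; 3; 16; 23; 25; 4; 6; 11; 25; 4; 7; 13; 14;
  4; 8; 19; 22; 4; 18; 21; 23; 5; 6; 17; 22; 5; 8; 10; 23; 5; 9; 14; 16;
  5; 15; 21; 25; 5; 18; 20; 24; 6; 10; 13; 21; 6; 12; 20; 23; 7; 9; 10; 20;
  7; 11; 16; 18; 7; 12; 22; 25; 7; 17; 23; 24; 8; 13; 16; 20; 8; 14; 17; 25;
  9; 12; 17; 21; 9; 13; 18; 25; 10; 15; 18; 22; 10; 16; 19; 24;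
  11; 12; 15; 24; 11; 14; 19; 23; 13; 15; 17; 19].

Definition blocks_2x3_5x4 : seq (seq nat) := quads [::
  0; 5; 10; 19; 0; 6; 14; 16; 0; 7; 13; 15; 0; 8; 20; 22; 0; 9; 21; 23;
  0; 11; 18; 24; 0; 12; 17; 25; 1; 5; 18; 20; 1; 6; 11; 17; 1; 7; 14; 24;
  1; 8; 12; 23; 1; 9; 10; 16; 1; 13; 19; 21; 1; 15; 22; 25; 2; 5; 17; 21;
  2; 6; 13; 25; 2; 7; 12; 18; 2; 8; 10; 15; 2; 9; 11; 22; 2; 14; 19; 20;
  2; 16; 23; 24; 3; 5; 12; 15; 3; 6; 19; 23; 3; 7; 11; 21; 3; 8; 13; 16;
  3; 9; 18; 25; 3; 10; 20; 24; 3; 14; 17; 22; 4; 5; 11; 16; 4; 6; 12; 20;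
  4; 7; 19; 22; 4; 8; 17; 24; 4; 9; 14; 15; 4; 10; 21; 25; 4; 13; 18; 23;
  5; 13; 22; 24; 5; 14; 23; 25; 6; 10; 18; 22; 6; 15; 21; 24; 7; 10; 17; 23;
  7; 16; 20; 25; 8; 11; 19; 25; 8; 14; 18; 21; 9; 12; 19; 24; 9; 13; 17; 20;
  11; 15; 20; 23; 12; 16; 21; 22].

Definition blocks_2x9_8x1 : seq (seq nat) := quads [::
  0; 8; 20; 25; 0; 9; 18; 22; 0; 10; 13; 24; 0; 11; 16; 19; 0; 12; 14; 21;
  0; 15; 17; 23; 1; 8; 16; 23; 1; 9; 12; 20; 1; 10; 21; 22; 1; 11; 14; 24;
  1; 13; 15; 18; 1; 17; 19; 25; 2; 8; 11; 22; 2; 9; 14; 17; 2; 10; 18; 25;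
  2; 12; 23; 24; 2; 13; 16; 20; 2; 15; 19; 21; 3; 8; 13; 19; 3; 9; 21; 23;
  3; 10; 12; 16; 3; 11; 15; 20; 3; 14; 22; 25; 3; 17; 18; 24; 4; 8; 12; 18;
  4; 9; 10; 15; 4; 11; 23; 25; 4; 13; 17; 22; 4; 14; 19; 20; 4; 16; 21; 24;
  5; 8; 10; 14; 5; 9; 19; 24; 5; 11; 12; 17; 5; 13; 21; 25; 5; 15; 16; 22;
  5; 18; 20; 23; 6; 8; 15; 24; 6; 9; 16; 25; 6; 10; 17; 20; 6; 11; 18; 21;
  6; 12; 19; 22; 6; 13; 14; 23; 7; 8; 17; 21; 7; 9; 11; 13; 7; 10; 19; 23;
  7; 12; 15; 25; 7; 14; 16; 18; 7; 20; 22; 24].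

Definition blocks_3x9 : seq (seq nat) := quads [::
  0; 3; 20; 22; 0; 4; 7; 21; 0; 5; 16; 18; 0; 6; 10; 13; 0; 8; 11; 12;
  0; 9; 14; 25; 0; 15; 23; 26; 0; 17; 19; 24; 1; 3; 12; 17; 1; 4; 18; 24;
  1; 5; 11; 20; 1; 6; 9; 26; 1; 7; 14; 19; 1; 8; 13; 22; 1; 10; 16; 23;
  1; 15; 21; 25; 2; 3; 18; 26; 2; 4; 9; 12; 2; 5; 6; 21; 2; 7; 16; 22;
  2; 8; 17; 25; 2; 10; 14; 20; 2; 11; 19; 23; 2; 13; 15; 24; 3; 6; 23; 25;
  3; 7; 10; 24; 3; 8; 19; 21; 3; 9; 13; 16; 3; 11; 14; 15; 4; 6; 15; 20;
  4; 8; 14; 23; 4; 10; 17; 22; 4; 11; 16; 25; 4; 13; 19; 26; 5; 7; 12; 15;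
  5; 8; 9; 24; 5; 10; 19; 25; 5; 13; 17; 23; 5; 14; 22; 26; 6; 11; 22; 24;
  6; 12; 16; 19; 6; 14; 17; 18; 7; 9; 18; 23; 7; 11; 17; 26; 7; 13; 20; 25;
  8; 10; 15; 18; 8; 16; 20; 26; 9; 15; 19; 22; 9; 17; 20; 21;
  10; 12; 21; 26; 11; 13; 18; 21; 12; 18; 22; 25; 12; 20; 23; 24;
  14; 16; 21; 24].

Definition blocks_3x5_6x2 : seq (seq nat) := quads [::
  0; 6; 17; 26; 0; 7; 20; 24; 0; 8; 14; 25; 0; 9; 12; 21; 0; 10; 15; 22;
  0; 11; 18; 23; 0; 13; 16; 19; 1; 6; 14; 18; 1; 7; 13; 15; 1; 8; 19; 26;
  1; 9; 20; 22; 1; 10; 16; 21; 1; 11; 12; 25; 1; 17; 23; 24; 2; 6; 13; 24;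
  2; 7; 12; 17; 2; 8; 16; 18; 2; 9; 15; 26; 2; 10; 14; 23; 2; 11; 19; 22;
  2; 20; 21; 25; 3; 6; 12; 19; 3; 7; 16; 25; 3; 8; 15; 20; 3; 9; 13; 23;
  3; 10; 18; 24; 3; 11; 17; 21; 3; 14; 22; 26; 4; 6; 15; 21; 4; 7; 18; 22;
  4; 8; 12; 23; 4; 9; 19; 24; 4; 10; 13; 25; 4; 11; 16; 26; 4; 14; 17; 20;
  5; 6; 22; 25; 5; 7; 23; 26; 5; 8; 21; 24; 5; 9; 14; 16; 5; 10; 17; 19;
  5; 11; 13; 20; 5; 12; 15; 18; 6; 16; 20; 23; 7; 14; 19; 21; 8; 13; 17; 22;
  9; 17; 18; 25; 10; 12; 20; 26; 11; 14; 15; 24; 12; 16; 22; 24;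
  13; 18; 21; 26; 15; 19; 23; 25].

Definition blocks_3x1_6x4 : seq (seq nat) := quads [::
  0; 6; 22; 25; 0; 7; 14; 20; 0; 8; 16; 23; 0; 9; 13; 19; 0; 10; 17; 26;
  0; 11; 15; 18; 0; 12; 21; 24; 1; 6; 15; 20; 1; 7; 17; 21; 1; 8; 12; 19;
  1; 9; 14; 25; 1; 10; 18; 24; 1; 11; 13; 23; 1; 16; 22; 26; 2; 6; 13; 18;
  2; 7; 15; 26; 2; 8; 20; 25; 2; 9; 17; 23; 2; 10; 12; 22; 2; 11; 16; 21;
  2; 14; 19; 24; 3; 6; 17; 19; 3; 7; 12; 18; 3; 8; 13; 24; 3; 9; 21; 26;
  3; 10; 16; 20; 3; 11; 14; 22; 3; 15; 23; 25; 4; 6; 14; 21; 4; 7; 23; 24;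
  4; 8; 17; 22; 4; 9; 16; 18; 4; 10; 15; 19; 4; 11; 12; 25; 4; 13; 20; 26;
  5; 6; 16; 24; 5; 7; 13; 22; 5; 8; 15; 21; 5; 9; 12; 20; 5; 10; 14; 23;
  5; 11; 19; 26; 5; 17; 18; 25; 6; 12; 23; 26; 7; 16; 19; 25; 8; 14; 18; 26;
  9; 15; 22; 24; 10; 13; 21; 25; 11; 17; 20; 24].

Definition blocks_4x7 : seq (seq nat) := quads [::
  0; 4; 8; 12; 0; 5; 23; 27; 0; 6; 19; 25; 0; 7; 10; 13; 0; 9; 17; 22;
  0; 11; 18; 24; 0; 14; 20; 26; 0; 15; 16; 21; 1; 4; 11; 14; 1; 5; 21; 25;
  1; 6; 20; 24; 1; 7; 9; 15; 1; 8; 16; 23; 1; 10; 18; 22; 1; 12; 19; 27;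
  1; 13; 17; 26; 2; 4; 17; 25; 2; 5; 8; 15; 2; 6; 10; 14; 2; 7; 18; 21;
  2; 9; 19; 23; 2; 11; 20; 27; 2; 12; 22; 26; 2; 13; 16; 24; 3; 4; 16; 20;
  3; 5; 11; 13; 3; 6; 9; 12; 3; 7; 22; 25; 3; 8; 19; 24; 3; 10; 21; 27;
  3; 14; 17; 23; 3; 15; 18; 26; 4; 9; 18; 27; 4; 10; 23; 26; 4; 13; 19; 21;
  4; 15; 22; 24; 5; 9; 16; 26; 5; 10; 17; 24; 5; 12; 18; 20; 5; 14; 19; 22;
  6; 8; 21; 26; 6; 11; 16; 22; 6; 13; 18; 23; 6; 15; 17; 27; 7; 8; 17; 20;
  7; 11; 19; 26; 7; 12; 23; 24; 7; 14; 16; 27; 8; 13; 22; 27; 8; 14; 18; 25;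
  9; 13; 20; 25; 9; 14; 21; 24; 10; 12; 16; 25; 10; 15; 19; 20;
  11; 12; 17; 21; 11; 15; 23; 25].

Definition blocks_1x2_4x3_7x2 : seq (seq nat) := quads [::
  0; 7; 16; 22; 0; 8; 21; 25; 0; 9; 17; 20; 0; 10; 18; 26; 0; 11; 14; 19;
  0; 12; 15; 24; 0; 13; 23; 27; 1; 7; 20; 23; 1; 8; 17; 24; 1; 9; 19; 26;
  1; 10; 16; 21; 1; 11; 15; 18; 1; 12; 25; 27; 1; 13; 14; 22; 2; 7; 15; 27;
  2; 8; 16; 20; 2; 9; 18; 22; 2; 10; 14; 25; 2; 11; 21; 24; 2; 12; 19; 23;
  2; 13; 17; 26; 3; 7; 17; 21; 3; 8; 14; 27; 3; 9; 15; 23; 3; 10; 19; 24;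
  3; 11; 20; 22; 3; 12; 16; 26; 3; 13; 18; 25; 4; 7; 14; 18; 4; 8; 15; 19;
  4; 9; 16; 25; 4; 10; 17; 23; 4; 11; 26; 27; 4; 12; 21; 22; 4; 13; 20; 24;
  5; 7; 24; 26; 5; 8; 18; 23; 5; 9; 21; 27; 5; 10; 15; 22; 5; 11; 17; 25;
  5; 12; 14; 20; 5; 13; 16; 19; 6; 7; 19; 25; 6; 8; 22; 26; 6; 9; 14; 24;
  6; 10; 20; 27; 6; 11; 16; 23; 6; 12; 17; 18; 6; 13; 15; 21;
  14; 21; 23; 26; 15; 20; 25; 26; 16; 18; 24; 27; 17; 19; 22; 27].

Definition blocks_7x4 : seq (seq nat) := quads [::
  0; 7; 16; 21; 0; 8; 20; 22; 0; 9; 15; 26; 0; 10; 18; 25; 0; 11; 19; 23;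
  0; 12; 14; 24; 0; 13; 17; 27; 1; 7; 19; 25; 1; 8; 16; 24; 1; 9; 14; 23;
  1; 10; 20; 26; 1; 11; 17; 22; 1; 12; 18; 27; 1; 13; 15; 21; 2; 7; 14; 22;
  2; 8; 15; 25; 2; 9; 16; 27; 2; 10; 17; 24; 2; 11; 18; 21; 2; 12; 19; 26;
  2; 13; 20; 23; 3; 7; 17; 26; 3; 8; 19; 27; 3; 9; 18; 22; 3; 10; 16; 23;
  3; 11; 15; 24; 3; 12; 20; 21; 3; 13; 14; 25; 4; 7; 20; 27; 4; 8; 18; 23;
  4; 9; 17; 25; 4; 10; 14; 21; 4; 11; 16; 26; 4; 12; 15; 22; 4; 13; 19; 24;
  5; 7; 15; 23; 5; 8; 17; 21; 5; 9; 20; 24; 5; 10; 19; 22; 5; 11; 14; 27;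
  5; 12; 16; 25; 5; 13; 18; 26; 6; 7; 18; 24; 6; 8; 14; 26; 6; 9; 19; 21;
  6; 10; 15; 27; 6; 11; 20; 25; 6; 12; 17; 23; 6; 13; 16; 22].

Definition blocks_2x12_5x1 : seq (seq nat) := quads [::
  0; 5; 14; 28; 0; 6; 10; 26; 0; 7; 17; 27; 0; 8; 9; 20; 0; 11; 13; 23;
  0; 12; 19; 21; 0; 15; 22; 24; 0; 16; 18; 25; 1; 5; 10; 22; 1; 6; 8; 28;
  1; 7; 16; 24; 1; 9; 19; 23; 1; 11; 18; 26; 1; 12; 20; 27; 1; 13; 15; 25;
  1; 14; 17; 21; 2; 5; 21; 25; 2; 6; 7; 18; 2; 8; 10; 24; 2; 9; 12; 26;
  2; 11; 15; 27; 2; 13; 20; 28; 2; 14; 22; 23; 2; 16; 17; 19; 3; 5; 11; 19;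
  3; 6; 12; 23; 3; 7; 13; 21; 3; 8; 14; 25; 3; 9; 15; 17; 3; 10; 16; 27;
  3; 18; 20; 22; 3; 24; 26; 28; 4; 5; 7; 9; 4; 6; 15; 19; 4; 8; 11; 21;
  4; 10; 13; 17; 4; 12; 18; 28; 4; 14; 20; 24; 4; 16; 22; 26; 4; 23; 25; 27;
  5; 8; 15; 18; 5; 12; 17; 24; 5; 13; 26; 27; 5; 16; 20; 23; 6; 9; 13; 22;
  6; 11; 14; 16; 6; 17; 20; 25; 6; 21; 24; 27; 7; 10; 11; 20; 7; 12; 22; 25;
  7; 14; 19; 26; 7; 15; 23; 28; 8; 12; 13; 16; 8; 17; 23; 26; 8; 19; 22; 27;
  9; 11; 24; 25; 9; 14; 18; 27; 9; 16; 21; 28; 10; 12; 14; 15;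
  10; 18; 21; 23; 10; 19; 25; 28; 11; 17; 22; 28; 13; 18; 19; 24;
  15; 20; 21; 26].

Definition blocks_2x2_5x5 : seq (seq nat) := quads [::
  0; 5; 12; 21; 0; 6; 11; 22; 0; 7; 10; 20; 0; 8; 13; 19; 0; 9; 15; 23;
  0; 14; 16; 24; 0; 17; 25; 28; 0; 18; 26; 27; 1; 5; 19; 27; 1; 6; 12; 16;
  1; 7; 22; 28; 1; 8; 11; 24; 1; 9; 13; 26; 1; 10; 17; 23; 1; 14; 18; 20;
  1; 15; 21; 25; 2; 5; 18; 24; 2; 6; 13; 23; 2; 7; 11; 15; 2; 8; 14; 28;
  2; 9; 17; 21; 2; 10; 19; 25; 2; 12; 22; 26; 2; 16; 20; 27; 3; 5; 11; 17;
  3; 6; 20; 25; 3; 7; 19; 24; 3; 8; 23; 27; 3; 9; 12; 18; 3; 10; 15; 22;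
  3; 13; 16; 28; 3; 14; 21; 26; 4; 5; 16; 22; 4; 6; 10; 18; 4; 7; 14; 17;
  4; 8; 15; 26; 4; 9; 20; 28; 4; 11; 21; 27; 4; 12; 19; 23; 4; 13; 24; 25;
  5; 10; 26; 28; 5; 13; 15; 20; 5; 14; 23; 25; 6; 14; 15; 27; 6; 17; 24; 26;
  6; 19; 21; 28; 7; 12; 25; 27; 7; 13; 18; 21; 7; 16; 23; 26; 8; 10; 16; 21;
  8; 12; 17; 20; 8; 18; 22; 25; 9; 10; 24; 27; 9; 11; 16; 25; 9; 14; 19; 22;
  11; 18; 23; 28; 11; 19; 20; 26; 12; 15; 24; 28; 13; 17; 22; 27].

Definition blocks_2x8_5x1_8x1 : seq (seq nat) := quads [::
  0; 8; 15; 24; 0; 9; 13; 20; 0; 10; 17; 19; 0; 11; 18; 23; 0; 12; 14; 16;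
  0; 21; 26; 27; 0; 22; 25; 28; 1; 8; 17; 26; 1; 9; 16; 18; 1; 10; 15; 22;
  1; 11; 19; 21; 1; 12; 20; 25; 1; 13; 23; 28; 1; 14; 24; 27; 2; 8; 19; 28;
  2; 9; 22; 27; 2; 10; 18; 20; 2; 11; 17; 24; 2; 12; 21; 23; 2; 13; 16; 26;
  2; 14; 15; 25; 3; 8; 14; 21; 3; 9; 23; 25; 3; 10; 13; 24; 3; 11; 20; 22;
  3; 12; 19; 26; 3; 15; 18; 28; 3; 16; 17; 27; 4; 8; 16; 23; 4; 9; 21; 28;
  4; 10; 25; 27; 4; 11; 15; 26; 4; 12; 22; 24; 4; 13; 18; 19; 4; 14; 17; 20;
  5; 8; 18; 25; 5; 9; 24; 26; 5; 10; 14; 23; 5; 11; 13; 27; 5; 12; 17; 28;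
  5; 15; 20; 21; 5; 16; 19; 22; 6; 8; 20; 27; 6; 9; 14; 19; 6; 10; 26; 28;
  6; 11; 16; 25; 6; 12; 13; 15; 6; 17; 22; 23; 6; 18; 21; 24; 7; 8; 13; 22;
  7; 9; 15; 17; 7; 10; 16; 21; 7; 11; 14; 28; 7; 12; 18; 27; 7; 19; 24; 25;
  7; 20; 23; 26; 13; 17; 21; 25; 14; 18; 22; 26; 15; 19; 23; 27;
  16; 20; 24; 28].

Definition blocks_3x8_6x1 : seq (seq nat) := quads [::
  0; 6; 14; 25; 0; 7; 11; 23; 0; 8; 10; 22; 0; 9; 13; 29; 0; 12; 15; 21;
  0; 16; 18; 26; 0; 17; 19; 28; 0; 20; 24; 27; 1; 6; 15; 18; 1; 7; 12; 27;
  1; 8; 9; 26; 1; 10; 14; 17; 1; 11; 13; 16; 1; 19; 21; 24; 1; 20; 22; 29;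
  1; 23; 25; 28; 2; 6; 10; 28; 2; 7; 14; 19; 2; 8; 13; 20; 2; 9; 18; 21;
  2; 11; 12; 24; 2; 15; 22; 25; 2; 16; 23; 27; 2; 17; 26; 29; 3; 6; 9; 20;
  3; 7; 16; 25; 3; 8; 11; 28; 3; 10; 23; 24; 3; 12; 18; 29; 3; 13; 15; 19;
  3; 14; 21; 26; 3; 17; 22; 27; 4; 6; 21; 27; 4; 7; 18; 22; 4; 8; 15; 24;
  4; 9; 12; 23; 4; 10; 19; 26; 4; 11; 14; 29; 4; 13; 17; 25; 4; 16; 20; 28;
  5; 6; 12; 17; 5; 7; 20; 26; 5; 8; 14; 27; 5; 9; 15; 28; 5; 10; 16; 21;
  5; 11; 18; 25; 5; 13; 22; 24; 5; 19; 23; 29; 6; 11; 19; 22; 6; 13; 23; 26;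
  6; 16; 24; 29; 7; 9; 17; 24; 7; 10; 15; 29; 7; 13; 21; 28; 8; 12; 16; 19;
  8; 17; 18; 23; 8; 21; 25; 29; 9; 14; 16; 22; 9; 19; 25; 27;
  10; 12; 20; 25; 10; 13; 18; 27; 11; 15; 26; 27; 11; 17; 20; 21;
  12; 22; 26; 28; 14; 15; 20; 23; 14; 18; 24; 28].

Definition blocks_3x4_6x3 : seq (seq nat) := quads [::
  0; 6; 14; 29; 0; 7; 13; 26; 0; 8; 24; 28; 0; 9; 17; 21; 0; 10; 15; 18;
  0; 11; 19; 23; 0; 12; 20; 25; 0; 16; 22; 27; 1; 6; 15; 20; 1; 7; 12; 23;
  1; 8; 17; 27; 1; 9; 18; 22; 1; 10; 25; 29; 1; 11; 13; 24; 1; 14; 19; 26;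
  1; 16; 21; 28; 2; 6; 16; 24; 2; 7; 21; 25; 2; 8; 13; 22; 2; 9; 12; 19;
  2; 10; 23; 27; 2; 11; 15; 26; 2; 14; 18; 28; 2; 17; 20; 29; 3; 6; 19; 27;
  3; 7; 16; 18; 3; 8; 14; 25; 3; 9; 15; 28; 3; 10; 13; 20; 3; 11; 21; 29;
  3; 12; 22; 24; 3; 17; 23; 26; 4; 6; 22; 26; 4; 7; 14; 27; 4; 8; 12; 29;
  4; 9; 20; 24; 4; 10; 16; 19; 4; 11; 17; 28; 4; 13; 18; 21; 4; 15; 23; 25;
  5; 6; 12; 21; 5; 7; 20; 28; 5; 8; 18; 26; 5; 9; 14; 23; 5; 10; 17; 22;
  5; 11; 16; 25; 5; 13; 19; 29; 5; 15; 24; 27; 6; 13; 23; 28; 6; 17; 18; 25;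
  7; 15; 22; 29; 7; 17; 19; 24; 8; 15; 19; 21; 8; 16; 20; 23; 9; 13; 25; 27;
  9; 16; 26; 29; 10; 12; 26; 28; 10; 14; 21; 24; 11; 12; 18; 27;
  11; 14; 20; 22; 18; 23; 24; 29; 19; 22; 25; 28; 20; 21; 26; 27].

Definition blocks_6x5 : seq (seq nat) := quads [::
  0; 6; 13; 20; 0; 7; 14; 24; 0; 8; 21; 26; 0; 9; 19; 25; 0; 10; 15; 22;
  0; 11; 12; 28; 0; 16; 18; 29; 0; 17; 23; 27; 1; 6; 15; 25; 1; 7; 12; 21;
  1; 8; 18; 24; 1; 9; 20; 27; 1; 10; 13; 29; 1; 11; 14; 23; 1; 16; 22; 26;
  1; 17; 19; 28; 2; 6; 14; 27; 2; 7; 22; 28; 2; 8; 16; 23; 2; 9; 13; 21;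
  2; 10; 17; 26; 2; 11; 19; 29; 2; 12; 18; 25; 2; 15; 20; 24; 3; 6; 23; 29;
  3; 7; 15; 26; 3; 8; 12; 20; 3; 9; 17; 22; 3; 10; 18; 28; 3; 11; 16; 27;
  3; 13; 19; 24; 3; 14; 21; 25; 4; 6; 17; 18; 4; 7; 23; 25; 4; 8; 13; 28;
  4; 9; 16; 24; 4; 10; 14; 19; 4; 11; 20; 26; 4; 12; 22; 27; 4; 15; 21; 29;
  5; 6; 22; 24; 5; 7; 16; 19; 5; 8; 17; 25; 5; 9; 12; 29; 5; 10; 21; 27;
  5; 11; 15; 18; 5; 13; 23; 26; 5; 14; 20; 28; 6; 12; 19; 26; 6; 16; 21; 28;
  7; 13; 18; 27; 7; 17; 20; 29; 8; 14; 22; 29; 8; 15; 19; 27; 9; 14; 18; 26;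
  9; 15; 23; 28; 10; 12; 23; 24; 10; 16; 20; 25; 11; 13; 22; 25;
  11; 17; 21; 24].

Definition blocks_3x7_9x1 : seq (seq nat) := quads [::
  0; 9; 12; 24; 0; 10; 13; 19; 0; 11; 18; 22; 0; 14; 26; 29; 0; 15; 23; 28;
  0; 16; 20; 21; 0; 17; 25; 27; 1; 9; 20; 28; 1; 10; 18; 26; 1; 11; 17; 29;
  1; 12; 15; 27; 1; 13; 16; 22; 1; 14; 21; 25; 1; 19; 23; 24; 2; 9; 15; 18;
  2; 10; 12; 23; 2; 11; 14; 20; 2; 13; 21; 29; 2; 16; 19; 25; 2; 17; 24; 28;
  2; 22; 26; 27; 3; 9; 25; 29; 3; 10; 20; 27; 3; 11; 16; 24; 3; 12; 18; 21;
  3; 13; 15; 26; 3; 14; 17; 23; 3; 19; 22; 28; 4; 9; 13; 23; 4; 10; 22; 25;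
  4; 11; 12; 28; 4; 14; 19; 27; 4; 15; 21; 24; 4; 16; 18; 29; 4; 17; 20; 26;
  5; 9; 17; 22; 5; 10; 14; 15; 5; 11; 19; 21; 5; 12; 16; 26; 5; 13; 25; 28;
  5; 18; 24; 27; 5; 20; 23; 29; 6; 9; 21; 27; 6; 10; 16; 28; 6; 11; 23; 26;
  6; 12; 20; 25; 6; 13; 17; 18; 6; 14; 22; 24; 6; 15; 19; 29; 7; 9; 19; 26;
  7; 10; 17; 21; 7; 11; 15; 25; 7; 12; 22; 29; 7; 13; 20; 24; 7; 14; 18; 28;
  7; 16; 23; 27; 8; 9; 14; 16; 8; 10; 24; 29; 8; 11; 13; 27; 8; 12; 17; 19;
  8; 15; 20; 22; 8; 18; 23; 25; 8; 21; 26; 28].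

(* Turns the n consecutive groups of size 4 from the point i on into blocks. *)
Definition fill (i n : nat) (bs : seq (seq nat)) : seq (seq nat) :=
  bs ++ [seq iota (i + 4 * j) 4 | j <- iota 0 n].

(** Groups of size 4 are always filled from the last one backwards: the singletons that arise then
    follow all larger groups, as the numbering of the new type demands. *)
Definition designs : seq (seq (nat * nat) * seq (seq nat)) := [::
  ([:: (1, 4)], blocks_1x4);
  ([:: (3, 4)], blocks_3x4);
  ([:: (1, 9); (4, 1)], blocks_1x9_4x1);
  ([:: (2, 7)], blocks_2x7);
  ([:: (3, 5)], blocks_3x5);
  ([:: (4, 4)], blocks_4x4);
  ([:: (2, 10)], blocks_2x10);
  ([:: (5, 4)], blocks_5x4);
  ([:: (3, 5); (6, 1)], blocks_3x5_6x1);
  ([:: (1, 15); (7, 1)], blocks_1x15_7x1);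
  ([:: (2, 9); (5, 1)], blocks_2x9_5x1);
  ([:: (3, 8)], blocks_3x8);
  ([:: (3, 4); (6, 2)], blocks_3x4_6x2);
  ([:: (1, 1); (4, 6)], blocks_1x1_4x6);
  ([:: (2, 13)], blocks_2x13);
  ([:: (2, 3); (5, 4)], blocks_2x3_5x4);
  ([:: (2, 9); (8, 1)], blocks_2x9_8x1);
  ([:: (3, 9)], blocks_3x9);
  ([:: (3, 5); (6, 2)], blocks_3x5_6x2);
  ([:: (3, 1); (6, 4)], blocks_3x1_6x4);
  ([:: (4, 7)], blocks_4x7);
  ([:: (1, 2); (4, 3); (7, 2)], blocks_1x2_4x3_7x2);
  ([:: (7, 4)], blocks_7x4);
  ([:: (2, 12); (5, 1)], blocks_2x12_5x1);
  ([:: (2, 2); (5, 5)], blocks_2x2_5x5);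
  ([:: (2, 8); (5, 1); (8, 1)], blocks_2x8_5x1_8x1);
  ([:: (3, 8); (6, 1)], blocks_3x8_6x1);
  ([:: (3, 4); (6, 3)], blocks_3x4_6x3);
  ([:: (6, 5)], blocks_6x5);
  ([:: (3, 7); (9, 1)], blocks_3x7_9x1);
  ([:: (1, 4); (4, 3)], fill 12 1 blocks_4x4);
  ([:: (1, 8); (4, 2)], fill 8 2 blocks_4x4);
  ([:: (1, 12); (4, 1)], fill 4 3 blocks_4x4);
  ([:: (1, 16)], fill 0 4 blocks_4x4);
  ([:: (1, 4); (4, 6)], fill 24 1 blocks_4x7);
  ([:: (1, 8); (4, 5)], fill 20 2 blocks_4x7);
  ([:: (1, 12); (4, 4)], fill 16 3 blocks_4x7);
  ([:: (1, 16); (4, 3)], fill 12 4 blocks_4x7);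
  ([:: (1, 20); (4, 2)], fill 8 5 blocks_4x7);
  ([:: (1, 24); (4, 1)], fill 4 6 blocks_4x7);
  ([:: (1, 28)], fill 0 7 blocks_4x7);
  ([:: (1, 5); (4, 5)], fill 20 1 blocks_1x1_4x6);
  ([:: (1, 9); (4, 4)], fill 16 2 blocks_1x1_4x6);
  ([:: (1, 13); (4, 3)], fill 12 3 blocks_1x1_4x6);
  ([:: (1, 17); (4, 2)], fill 8 4 blocks_1x1_4x6);
  ([:: (1, 21); (4, 1)], fill 4 5 blocks_1x1_4x6);
  ([:: (1, 25)], fill 0 6 blocks_1x1_4x6);
  ([:: (1, 13)], fill 0 1 blocks_1x9_4x1);
  ([:: (1, 6); (4, 2); (7, 2)], fill 22 1 blocks_1x2_4x3_7x2);
  ([:: (1, 10); (4, 1); (7, 2)], fill 18 2 blocks_1x2_4x3_7x2);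
  ([:: (1, 14); (7, 2)], fill 14 3 blocks_1x2_4x3_7x2)
].

Lemma designs_check :
  all (fun d => gdd_check 4 (expo_type d.1) d.2) designs.
Proof. by vm_compute. Qed.

Lemma designs_complete :
  all (fun s => (s \in exceptional_types) ||
    (s \in [seq expo_type d.1 | d <- designs])) listed_types.
Proof. by vm_compute. Qed.

Lemma listed_gdd_exists (s : seq nat) :
  s \in listed_types -> s \notin exceptional_types -> gdd_exists 4 s.
Proof.
move=> sl se; have /orP[|/mapP[d dd ->]] := allP designs_complete _ sl.
  by rewrite (negPf se).
exact: gdd_check_sound (allP designs_check _ dd).
Qed.

(** * Exhaustive search *)

Definition covers (p : nat * nat) (o : bitseq) : bool :=
  nth false o p.1 && nth false o p.2.

Definition compatible (o o' : bitseq) : bool :=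
  count (fun bc => bc.1 && bc.2) (zip o o') <= 1.

(** Branching heuristic: a pair with the fewest candidate blocks, the scan stopping early when at
    most one candidate is left. Soundness only needs the result to be one of the pairs. *)
Fixpoint select (os : seq bitseq) (p : nat * nat) (c : nat)
    (ps : seq (nat * nat)) : nat * nat :=
  if c <= 1 then p else
  if ps is q :: ps' then
    let d := count (covers q) os in
    if d < c then select os q d ps' else select os p c ps'
  else p.

(* Backtracking over exact covers of the pairs ps by mutually compatible blocks
   from os: true certifies that there is none, false includes lack of fuel. *)
Fixpoint refute (n : nat) (ps : seq (nat * nat)) (os : seq bitseq) : bool :=
  if n is n'.+1 then
    if ps is p :: ps' then
      let q := select os p (count (covers p) os) ps' in
      all (fun o => refute n' [seq r <- ps | ~~ covers r o]
        [seq o' <- os | compatible o o']) [seq o <- os | covers q o]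
    else false
  else false.

Fixpoint weight_bitseqs (n k : nat) : seq bitseq :=
  if n is n'.+1 then
    (if k is k'.+1 then [seq true :: o | o <- weight_bitseqs n' k'] else [::])
    ++ [seq false :: o | o <- weight_bitseqs n' k]
  else if k is 0 then [:: [::]] else [::].

Lemma select_mem os p c ps : select os p c ps \in p :: ps.
Proof.
elim: ps p c => [|q ps IH] p c /=; first by case: ifP; rewrite mem_head.
case: ifP => _; first by rewrite mem_head.
case: ifP => _; first by rewrite in_cons IH orbT.
by have := IH p c; rewrite !in_cons => /orP[->|->] //; rewrite !orbT.
Qed.

(** [D] stands for the blocks of a hypothetical design. The block of [D] covering the selected pair
    is among the candidates, so one branch agrees with [D]. A pair left uncovered in that branch is
    covered by a different block of [D], which is compatible with the chosen one and survives the
    filter. *)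
Lemma refute_sound (D : bitseq -> Prop) n ps os :
  (forall o o', D o -> D o' -> o != o' -> compatible o o') ->
  (forall p, p \in ps -> exists o, [/\ D o, o \in os & covers p o]) ->
  refute n ps os -> False.
Proof.
move=> Dcompat; elim: n ps os => // n IH [|p ps] os //= Dcov.
set q := select _ _ _ _; have [o [Do os_o qo]] := Dcov q (select_mem _ _ _ _).
move/allP/(_ o); rewrite mem_filter os_o qo => /(_ isT); apply: IH => r.
move: (Dcov r); rewrite -/(filter _ (p :: ps)) mem_filter.
move=> Dr /andP[ro /Dr[o' [Do' os_o' ro']]]; exists o'; split=> //.
rewrite mem_filter os_o' andbT; apply: Dcompat => //.
by apply: contraNneq ro => ->.
Qed.

Lemma mem_weight_bitseqs o : o \in weight_bitseqs (size o) (count id o).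
Proof.
elim: o => //= -[] o IH /=; rewrite ?add1n ?add0n mem_cat.
  by rewrite (map_f (cons true) IH).
by rewrite (map_f (cons false) IH) orbT.
Qed.

(** * Incidence and counting in a group divisible design *)

Section GDD.

Variables (k : nat) (X : finType) (G B : {set {set X}}).
Hypothesis GB : is_gdd k G B.

Lemma gdd_card (s : seq nat) : perm_eq (group_sizes G) s -> #|X| = sumn s.
Proof.
move=> Gs; rewrite -cardsT (card_partition (gdd_groups GB)) -(perm_sumn Gs).
by rewrite sumnE big_map big_enum.
Qed.

Lemma gdd_pblock x : pblock G x \in G.
Proof.
by apply: pblock_mem; rewrite (cover_partition (gdd_groups GB)) inE.
Qed.

Lemma gdd_mem_pblock x : x \in pblock G x.
Proof. by rewrite mem_pblock (cover_partition (gdd_groups GB)) inE. Qed.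

Lemma gdd_def_pblock g x : g \in G -> x \in g -> pblock G x = g.
Proof. by have /and3P[_ tG _] := gdd_groups GB; apply: def_pblock. Qed.

Lemma gdd_block_group b g x y :
  b \in B -> g \in G -> x \in b -> y \in b -> x \in g -> y \in g -> x = y.
Proof.
move=> bB gG xb yb xg yg; have /card_le1_eqP := gdd_transverse GB bB gG.
by apply; rewrite inE ?xb ?yb.
Qed.

Lemma gdd_joined g h x y : g \in G -> h \in G -> g != h -> x \in g -> y \in h ->
  exists2 b, b \in B & (x \in b) && (y \in b).
Proof.
move=> gG hG gh xg yh; have /eqP/cards1P[b bE] := gdd_pairs GB gG hG gh xg yh.
by have := set11 b; rewrite -bE inE => /andP[]; exists b.
Qed.

(** Distinct points of a block lie in distinct groups, so only one block contains both. *)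
Lemma gdd_block_eq b c x y : b \in B -> c \in B -> x != y ->
  x \in b -> y \in b -> x \in c -> y \in c -> b = c.
Proof.
move=> bB cB xy xb yb xc yc.
have xy' : pblock G x != pblock G y.
  apply: contraNneq xy => e; apply/eqP.
  apply: (gdd_block_group bB (gdd_pblock x)) => //; first exact: gdd_mem_pblock.
  by rewrite e gdd_mem_pblock.
have /eqP/cards1P[d dE] := gdd_pairs GB (gdd_pblock x) (gdd_pblock y) xy'
  (gdd_mem_pblock x) (gdd_mem_pblock y).
have /set1P -> : b \in [set d] by rewrite -dE inE bB xb.
by apply/esym/set1P; rewrite -dE inE cB xc.
Qed.

Lemma gdd_card_meet b c : b \in B -> c \in B -> b != c -> #|b :&: c| <= 1.
Proof.
move=> bB cB bc; apply/card_le1_eqP => x y; rewrite !inE.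
move=> /andP[xb xc] /andP[yb yc]; apply/eqP; apply: contraNT bc => xy.
by rewrite (gdd_block_eq bB cB xy).
Qed.

(** Double counting: every point of [T] is in another group than [x], hence on exactly one of the
    blocks through [x]. *)
Lemma gdd_sum_through g x (T : {set X}) : g \in G -> x \in g -> [disjoint T & g] ->
  \sum_(b in B | x \in b) #|b :&: T| = #|T|.
Proof.
move=> gG xg Tg.
transitivity (\sum_(b in B | x \in b) \sum_(t in T) (t \in b : nat)).
  apply: eq_bigr => b _; rewrite setIC -sum1_card big_mkcond [RHS]big_mkcond /=.
  by apply: eq_bigr => t _; rewrite inE; case: (t \in T); case: (t \in b).
rewrite exchange_big /= -sum1_card; apply: eq_bigr => t tT.
have gt : pblock G t != g.
  apply: contraTneq (gdd_mem_pblock t) => ->; move: Tg.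
  by rewrite disjoint_subset => /subsetP/(_ _ tT).
rewrite eq_sym in gt.
have <- := gdd_pairs GB gG (gdd_pblock t) gt xg (gdd_mem_pblock t).
rewrite -sum1_card [RHS]big_mkcond [LHS]big_mkcond /=; apply: eq_bigr => b _.
by rewrite inE; case: (b \in B); case: (x \in b); case: (t \in b).
Qed.

End GDD.

(** * Designs with numbered points *)

Section Names.

Variables (X : finType) (G B : {set {set X}}) (x0 : X) (pts : seq X).
Hypotheses (GB : is_gdd 4 G B) (pts_uniq : uniq pts) (pts_size : size pts = #|X|).

Definition bits (b : {set X}) : bitseq := [seq x \in b | x <- pts].

Lemma nth_bits b i : i < #|X| -> nth false (bits b) i = (nth x0 pts i \in b).
Proof. by move=> iX; rewrite (nth_map x0) ?pts_size. Qed.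

Lemma count_bits b I : all (gtn #|X|) I ->
  count (nth false (bits b)) I = count (mem b) [seq nth x0 pts i | i <- I].
Proof.
move=> /allP IX; rewrite count_map; apply: eq_in_count => i iI /=.
by rewrite nth_bits //; apply: IX.
Qed.

Lemma all_bits b I : all (gtn #|X|) I ->
  all (nth false (bits b)) I = all (mem b) [seq nth x0 pts i | i <- I].
Proof.
move=> /allP IX; rewrite all_map; apply: eq_in_all => i iI /=.
by rewrite nth_bits //; apply: IX.
Qed.

Lemma mem_pts x : x \in pts.
Proof.
suff : pts =i X by move->.
by apply/subset_cardP; rewrite ?(card_uniqP pts_uniq) //; apply/subsetP.
Qed.

Lemma count_pts_card (A : {set X}) : count (mem A) pts = #|A|.
Proof.
rewrite -size_filter -(card_uniqP _) ?filter_uniq //.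
by apply: eq_card => x; rewrite mem_filter mem_pts andbT.
Qed.

Lemma bits_compatible b c : b \in B -> c \in B -> bits b != bits c ->
  compatible (bits b) (bits c).
Proof.
move=> bB cB bc; rewrite /compatible /bits zip_map count_map.
rewrite (eq_count (a2 := mem (b :&: c))); last by move=> x; rewrite /= inE.
rewrite count_pts_card (gdd_card_meet GB) //.
by apply: contraNneq bc => ->.
Qed.

(** Bridge from designs to the search: [ok] gathers what is known of every block under the numbering
    [pts], and the candidates are the 4-subsets that pass it. The listed pairs need not be all pairs
    from distinct groups. *)
Lemma refute_gdd n ps (ok : pred bitseq) :
  (forall b, b \in B -> ok (bits b)) ->
  all (fun p => [&& p.1 < #|X|, p.2 < #|X| &
    pblock G (nth x0 pts p.1) != pblock G (nth x0 pts p.2)]) ps ->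
  refute n ps [seq o <- weight_bitseqs #|X| 4 | ok o] -> False.
Proof.
move=> okB /allP psP.
apply: (@refute_sound (fun o => exists2 b, b \in B & o = bits b)) => [|p pps].
  by move=> _ _ [b bB ->] [c cB ->]; apply: bits_compatible.
have /and3P[p1 p2 p12] := psP p pps.
have [b bB /andP[xb yb]] := gdd_joined GB (gdd_pblock GB _) (gdd_pblock GB _) p12
  (gdd_mem_pblock GB _) (gdd_mem_pblock GB _).
exists (bits b); split; first by exists b.
  rewrite mem_filter okB //= -(gdd_blocks GB bB) -count_pts_card.
  have -> : count (mem b) pts = count id (bits b) by rewrite count_map.
  have {1}-> : #|X| = size (bits b) by rewrite size_map pts_size.
  exact: mem_weight_bitseqs.
by rewrite /covers !nth_bits // xb yb.
Qed.

Definition at_most_one (I : seq nat) (o : bitseq) : bool :=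
  count (nth false o) I <= 1.

(* Points of a common block: a block with two of them contains them all. *)
Definition collinear_rule (I : seq nat) (o : bitseq) : bool :=
  at_most_one I o || all (nth false o) I.

Lemma count_bits_le b (A : {set X}) I : all (gtn #|X|) I -> uniq I ->
  {in I, forall i, nth x0 pts i \in A} -> count (nth false (bits b)) I <= #|b :&: A|.
Proof.
move=> IX Iu IA; rewrite count_bits // -size_filter.
rewrite -(card_uniqP (filter_uniq _ _)); last first.
  rewrite map_inj_in_uniq // => i j iI jI /eqP.
  by have [iX jX] := (allP IX i iI, allP IX j jI); rewrite nth_uniq ?pts_size // => /eqP.
apply: subset_leq_card; apply/subsetP => x.
rewrite mem_filter => /andP[xb /mapP[i iI xE]].
by apply/setIP; split; [exact: xb | rewrite xE IA].
Qed.

Lemma at_most_one_bits b g I : b \in B -> g \in G -> all (gtn #|X|) I -> uniq I ->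
  {in I, forall i, nth x0 pts i \in g} -> at_most_one I (bits b).
Proof.
move=> bB gG IX Iu Ig.
exact: leq_trans (count_bits_le b IX Iu Ig) (gdd_transverse GB bB gG).
Qed.

Lemma collinear_rule_bits b c I : b \in B -> c \in B -> all (gtn #|X|) I -> uniq I ->
  {in I, forall i, nth x0 pts i \in c} -> collinear_rule I (bits b).
Proof.
move=> bB cB IX Iu Ic; rewrite /collinear_rule.
have [->|bc] := eqVneq b c; last first.
  by rewrite /at_most_one (leq_trans (count_bits_le b IX Iu Ic)) ?(gdd_card_meet GB).
by rewrite all_bits // all_map; apply/orP; right; apply/allP => i /Ic.
Qed.

End Names.

(** * Type 2^6 5^1 *)

Section TwoMatchings.

Variables (T : finType) (Z : {set T}) (p m : T -> T).

Definition matching_on (f : T -> T) :=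
  {in Z, forall x, [/\ f x \in Z, f (f x) = x & f x != x]}.

Hypotheses (pP : matching_on p) (mP : matching_on m).
Hypothesis pm : {in Z, forall x, m x != p x}.

(* c is a union of cycles alternating between p and m and of one alternating
   chain from s to e that starts and ends with an edge of p. *)
Definition open_chain (c : seq T) (s e : T) :=
  [/\ uniq c, {subset c <= Z}, {in c, forall x, p x \in c}, [&& s \in c, e \in c & s != e]
    & {in c, forall x, x != s -> x != e -> [/\ m x \in c, m x != s & m x != e]}].

(** Since [c] is closed under the involution [p], a point outside [c] has its [p]-image outside as
    well. *)
Lemma open_chain_add c z :
  uniq c -> {subset c <= Z} -> {in c, forall x, p x \in c} -> z \in Z -> z \notin c ->
  [/\ uniq (c ++ [:: z; p z]), {subset c ++ [:: z; p z] <= Z}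
    & {in c ++ [:: z; p z], forall x, p x \in c ++ [:: z; p z]}].
Proof.
move=> cu cZ cp zZ zc; have [pzZ ppz pzz] := pP zZ.
have pzc : p z \notin c by apply: contra zc => /cp; rewrite ppz.
split.
- by rewrite cat_uniq cu /= !orbF negb_or zc pzc inE eq_sym pzz.
- by move=> x; rewrite mem_cat !inE => /or3P[/cZ //|/eqP ->|/eqP ->].
move=> x; rewrite !mem_cat !inE => /or3P[/cp -> //|/eqP ->|/eqP ->].
  by rewrite eqxx !orbT.
by rewrite ppz eqxx orbT.
Qed.

Lemma open_chain_start z : z \in Z -> open_chain [:: z; p z] z (p z).
Proof.
move=> zZ; case: (@open_chain_add [::] z) => // cu cZ cp.
split=> //; first by have [_ _] := pP zZ; rewrite !inE !eqxx orbT eq_sym.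
by move=> x; rewrite !inE => /orP[] /eqP ->; rewrite ?eqxx.
Qed.

(** If [m e] is in [c] it must be [s]: at any other point than the two ends, [m] avoids [e], whereas
    it takes [m e] back to [e]. Otherwise [m e] and its [p]-partner prolong the chain. *)
Lemma open_chain_step c s e : open_chain c s e ->
  m e = s \/ open_chain (c ++ [:: m e; p (m e)]) s (p (m e)).
Proof.
case=> cu cZ cp /and3P[sc ec se] ci; have eZ := cZ _ ec.
have [meZ mme mee] := mP eZ.
have [mec|mec] := boolP (m e \in c).
  left; apply/eqP; apply: contraTT isT => mes.
  by have [_ _] := ci _ mec mes mee; rewrite mme eqxx.
right; have [nu nZ np] := open_chain_add cu cZ cp meZ mec.
have pmec : p (m e) \notin c.
  by move: nu; rewrite cat_uniq => /and3P[_]; rewrite /= !negb_or => /and3P[].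
have neq x : x \in c -> x != p (m e) by move=> xc; apply: contraNneq pmec => <-.
split=> //; first by rewrite !mem_cat sc !inE eqxx !orbT neq.
move=> x; rewrite !mem_cat !inE => /or3P[xc xs _|/eqP -> _ _|/eqP ->]; last by rewrite eqxx.
  have [->|xe] := eqVneq x e.
    rewrite eqxx orbT; split=> //; first by apply: contraNneq mec => ->.
    by have [_ _] := pP meZ; rewrite eq_sym.
  by have [mxc mxs _] := ci _ xc xs xe; rewrite mxc mxs neq.
by rewrite mme ec; split=> //; [rewrite eq_sym | apply: neq].
Qed.

(** Once the chain has closed into a cycle, [c] is stable under [m] too, so a fresh point can start
    the next chain. *)
Lemma open_chain_restart c s e z : open_chain c s e -> m e = s ->
  z \in Z -> z \notin c -> open_chain (c ++ [:: z; p z]) z (p z).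
Proof.
case=> cu cZ cp /and3P[sc ec se] ci mes zZ zc; have eZ := cZ _ ec.
have [nu nZ np] := open_chain_add cu cZ cp zZ zc.
have pzc : p z \notin c.
  by move: nu; rewrite cat_uniq => /and3P[_]; rewrite /= !negb_or => /and3P[].
split=> //.
  by have [_ _] := pP zZ; rewrite !mem_cat !inE !eqxx !orbT eq_sym.
have cm x : x \in c -> m x \in c.
  move=> xc; have [->|xe] := eqVneq x e; first by rewrite mes.
  have [->|xs] := eqVneq x s; first by rewrite -mes; have [_ ->] := mP eZ.
  by have [] := ci _ xc xs xe.
move=> x; rewrite !mem_cat !inE => /or3P[xc _ _|/eqP ->|/eqP ->]; rewrite ?eqxx //.
by rewrite cm //; split=> //; [apply: contraNneq zc | apply: contraNneq pzc] => <-; rewrite cm.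
Qed.

(** As [m] and [p] share no edge, a chain consisting of one edge of [p] cannot close: every cycle
    has at least two such edges. *)
Lemma open_chain_turn z : z \in Z -> m (p z) <> z.
Proof.
move=> zZ; have [pzZ ppz _] := pP zZ.
by have := pm pzZ; rewrite ppz => /eqP.
Qed.

Hypothesis Z10 : #|Z| = 10.

(** No point of [Z] is left to prolong the chain. *)
Lemma open_chain_full c s e : open_chain c s e -> size c = 10 -> m e = s.
Proof.
case=> cu cZ cp /and3P[sc ec se] ci sz; have [meZ mme mee] := mP (cZ _ ec).
have cE : c =i Z.
  apply/subset_cardP; last exact/subsetP.
  by rewrite Z10 (card_uniqP cu).
apply/eqP; apply: contraTT isT => mes.
by rewrite -cE in meZ; have [_ _] := ci _ meZ mes mee; rewrite mme eqxx.
Qed.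

Lemma open_chain_fresh c s e : open_chain c s e -> size c < 10 ->
  exists2 z, z \in Z & z \notin c.
Proof.
case=> cu _ _ _ _ sz; apply/subsetPn; apply/negP => Zc.
have := subset_leq_card Zc; rewrite Z10 (card_uniqP cu) leqNgt sz //.
Qed.

Definition alternates (mates : seq (nat * nat)) (c : seq T) (x0 : T) :=
  [/\ uniq c, {subset c <= Z}, size c = 10,
      forall i, i < 5 -> p (nth x0 c (2 * i)) = nth x0 c (2 * i).+1 &
      {in mates, forall ij, m (nth x0 c ij.1) = nth x0 c ij.2}].

(** Cycles are named by their number of edges of [p], which join positions 2i and 2i + 1: a
    five-cycle is the 10-cycle, a two- and a three-cycle are the 4-cycle and the 6-cycle. The pairs
    list the edges of [m] by position. *)
Definition five_cycle := [:: (1, 2); (3, 4); (5, 6); (7, 8); (9, 0)].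
Definition two_three_cycles := [:: (1, 2); (3, 0); (5, 6); (7, 8); (9, 4)].

(** The five edges of [p] are distributed over cycles with at least two of them each, and 5 = 2 + 3
    is the only proper way to do so. *)
Lemma two_matchings x0 :
  exists c, alternates five_cycle c x0 \/ alternates two_three_cycles c x0.
Proof.
have [z zZ] : exists z, z \in Z by apply/card_gt0P; rewrite Z10.
have alt c mates : uniq c -> {subset c <= Z} -> size c = 10 ->
    all (fun i => p (nth x0 c (2 * i)) == nth x0 c (2 * i).+1) (iota 0 5) ->
    all (fun ij => m (nth x0 c ij.1) == nth x0 c ij.2) mates ->
    alternates mates c x0.
  move=> cu cZ sz pc mc; split=> // [i i5|ij ijm]; last exact/eqP/(allP mc).
  by apply/eqP/(allP pc); rewrite mem_iota.
have h2 := open_chain_start zZ.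
have [eq_h4|h4] := open_chain_step h2; first by case: (open_chain_turn zZ eq_h4).
have [m4|h6] := open_chain_step h4.
  have [y yZ yc] := open_chain_fresh h4 isT.
  have k6 := open_chain_restart h4 m4 yZ yc.
  have [eq_k8|k8] := open_chain_step k6; first by case: (open_chain_turn yZ eq_k8).
  have [m8|k10] := open_chain_step k8.
    (* Two points remain; their chain would have to close after a single edge of [p]. *)
    have [w wZ wc] := open_chain_fresh k8 isT.
    by case: (open_chain_turn wZ (open_chain_full (open_chain_restart k8 m8 wZ wc) erefl)).
  have m10 := open_chain_full k10 erefl; case: k10 => cu cZ _ _ _.
  by eexists; right; apply: alt cu cZ _ _ _; rewrite //= ?m4 ?m10 !eqxx.
have [m6|h8] := open_chain_step h6.
  have [y yZ yc] := open_chain_fresh h6 isT.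
  have k8 := open_chain_restart h6 m6 yZ yc.
  have [eq_k10|k10] := open_chain_step k8; first by case: (open_chain_turn yZ eq_k10).
  have m10 := open_chain_full k10 erefl; case: k10 => cu cZ _ _ _.
  set c := _ ++ _ in cu cZ.
  (* Here the 6-cycle was found before the 4-cycle; the rotation puts the 4-cycle at positions 0 to
     3, as [two_three_cycles] has it. *)
  exists (rot 6 c); right; apply: alt; rewrite ?rot_uniq ?size_rot //.
  - by move=> x; rewrite mem_rot => /cZ.
  - by rewrite /= !eqxx.
  by rewrite /= m6 m10 !eqxx.
have [m8|k10] := open_chain_step h8.
  have [w wZ wc] := open_chain_fresh h8 isT.
  by case: (open_chain_turn wZ (open_chain_full (open_chain_restart h8 m8 wZ wc) erefl)).
have m10 := open_chain_full k10 erefl; case: k10 => cu cZ _ _ _.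
by eexists; left; apply: alt cu cZ _ _ _; rewrite //= ?m10 !eqxx.
Qed.

End TwoMatchings.

(** Numbering: 0 is a point off the group of size 5 and 1 the other point of its group; 2 to 11 are
    the ten matched points, whence the shift by two; 12 to 16 form the group of size 5, where 12 + k
    lies on the block through 0 and the k-th pair of mates. *)
Definition ok_2x6_5x1 (mates : seq (nat * nat)) (o : bitseq) : bool :=
  [&& all (fun i => at_most_one [:: 2 * i; (2 * i).+1] o) (iota 0 6),
      count (nth false o) (iota 12 5) == 1 &
      all (fun k => let m := nth (0, 0) mates k in
        collinear_rule [:: 0; m.1.+2; m.2.+2; 12 + k] o) (iota 0 5)].

(** Every candidate block has one point in the group of size 5 and hence covers three of these 60
    pairs, so they already determine all 20 blocks. This is why the search gets fuel 21. *)
Definition cross_2x6_5x1 := [seq (i, j) | i <- iota 0 12, j <- iota 12 5].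

(** Besides the search, it records that [mates] matches ten positions in five pairs, so that both
    cycle structures are excluded by one argument. *)
Definition refuted_mates (mates : seq (nat * nat)) : bool :=
  [&& size mates == 5, all (fun ij => (ij.1 < 10) && (ij.2 < 10)) mates,
      uniq (unzip1 mates ++ unzip2 mates) &
      refute 21 cross_2x6_5x1 [seq o <- weight_bitseqs 17 4 | ok_2x6_5x1 mates o]].

Lemma five_cycle_refuted : refuted_mates five_cycle.
Proof. by vm_compute. Qed.

Lemma two_three_cycles_refuted : refuted_mates two_three_cycles.
Proof. by vm_compute. Qed.

(** * The two matchings of a design of type 2^6 5^1 *)

Section Type_2x6_5x1.

Variables (X : finType) (G B : {set {set X}}) (Y : {set X}).
Hypotheses (GB : is_gdd 4 G B) (YG : Y \in G) (Y5 : #|Y| = 5) (X17 : #|X| = 17).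
Hypothesis card2 : {in G, forall g, g != Y -> #|g| = 2}.

Let pb_neqY x : x \notin Y -> pblock G x != Y.
Proof. by apply: contraNneq => <-; apply: gdd_mem_pblock GB _. Qed.

Let disjG g h : g \in G -> h \in G -> g != h -> [disjoint g & h].
Proof.
by have /and3P[_ /trivIsetP tG _] := gdd_groups GB; apply: tG.
Qed.

(** Take a point x of [b] off [Y]. The blocks through x share out the 15 points off its group, three
    on each, so there are five. They also share out the five points of [Y], at most one on each, so
    each of them has exactly one. *)
Let card_blockY b : b \in B -> #|b :&: Y| = 1.
Proof.
move=> bB; have b4 := gdd_blocks GB bB.
have [x xb xY] : exists2 x, x \in b & x \notin Y.
  apply/subsetPn; apply: contraTN (gdd_transverse GB bB YG) => bY.
  by rewrite (setIidPl bY) b4.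
have gG := gdd_pblock GB x; have xg := gdd_mem_pblock GB x.
have gY := pb_neqY xY; set g := pblock G x in gG xg gY.
have /eqP : \sum_(c in B | x \in c) #|c :&: ~: g| = 15.
  rewrite (gdd_sum_through GB gG xg); last by rewrite disjoints_subset.
  by rewrite cardsCs setCK X17 card2.
rewrite (eq_bigr (fun=> 3)); last first.
  move=> c /andP[cB xc]; apply/eqP; rewrite -setDE -(eqn_add2l #|c :&: g|) cardsID.
  rewrite (gdd_blocks GB cB) (_ : #|c :&: g| = 1) //.
  apply/eqP; rewrite eqn_leq (gdd_transverse GB cB gG) card_gt0.
  by apply/set0Pn; exists x; rewrite inE xc.
rewrite sum_nat_const (eqn_pmul2r (n2 := 5)) // => /eqP r5.
have := gdd_sum_through GB gG xg (disjG YG gG _); rewrite eq_sym => /(_ gY).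
have le c : (c \in B) && (x \in c) -> #|c :&: Y| <= 1 ?= iff (#|c :&: Y| == 1).
  by case/andP=> cB _; apply/leqif_eq/(gdd_transverse GB).
have [_] := leqif_sum le; rewrite sum_nat_const r5 => {}le e.
move: le; rewrite e Y5 eqxx => /esym/forall_inP/(_ b).
by rewrite bB xb => /(_ isT)/eqP.
Qed.

Let card_blockDY b : b \in B -> #|b :\: Y| = 3.
Proof.
move=> bB; apply/eqP; rewrite -(eqn_add2l #|b :&: Y|) cardsID.
by rewrite card_blockY // (gdd_blocks GB bB).
Qed.

Let partner x := odflt x [pick y | (y \in pblock G x) && (y != x)].

Let partnerP x : x \notin Y -> (partner x \in pblock G x) && (partner x != x).
Proof.
move=> xY; rewrite /partner; case: pickP => //= none.
have := card2 (gdd_pblock GB x) (pb_neqY xY).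
rewrite (cardsD1 x) (gdd_mem_pblock GB) => -[] /eqP; rewrite eq_sym.
rewrite (_ : _ :\ x = set0) ?cards0 //; apply/setP => y; rewrite !inE andbC.
exact: none.
Qed.

Let partner_uniq x y : x \notin Y -> y \in pblock G x -> y != x -> y = partner x.
Proof.
move=> xY yx nyx; have /andP[px npx] := partnerP xY.
have := card2 (gdd_pblock GB x) (pb_neqY xY).
rewrite (cardsD1 x) (gdd_mem_pblock GB) => -[] /eqP/cards1P[z zE].
have : y \in pblock G x :\ x by rewrite !inE nyx.
have : partner x \in pblock G x :\ x by rewrite !inE npx.
by rewrite zE !inE => /eqP -> /eqP.
Qed.

Variable x0 : X.
Hypothesis x0Y : x0 \notin Y.

Let Z := ~: (Y :|: pblock G x0).

Let inZ x : (x \in Z) = (x \notin Y) && (x \notin pblock G x0).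
Proof. by rewrite !inE negb_or. Qed.

Let pb_eq x y : x \in pblock G y -> pblock G x = pblock G y.
Proof. by move=> xy; rewrite (gdd_def_pblock GB (gdd_pblock GB y) xy). Qed.

Let card_Z : #|Z| = 10.
Proof.
have := cardsC (Y :|: pblock G x0); rewrite -/Z X17 cardsU.
have -> : Y :&: pblock G x0 = set0.
  by apply/eqP; rewrite setI_eq0 disjG ?(gdd_pblock GB) // eq_sym pb_neqY.
by rewrite cards0 Y5 (card2 (gdd_pblock GB x0) (pb_neqY x0Y)) => -[].
Qed.

Let partner_matching : matching_on Z partner.
Proof.
move=> x; rewrite inZ => /andP[xY xx0]; have /andP[px npx] := partnerP xY.
have pY : partner x \notin Y.
  apply: contraNN xY => pY.
  by rewrite -(gdd_def_pblock GB YG pY) (pb_eq px) (gdd_mem_pblock GB).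
split=> //.
  rewrite inZ pY; apply: contraNN xx0 => /pb_eq <-.
  by rewrite (pb_eq px) (gdd_mem_pblock GB).
by apply/esym/partner_uniq; rewrite // ?(pb_eq px) ?(gdd_mem_pblock GB) // eq_sym.
Qed.

(** The block joining [x0] to [x] has exactly three points off [Y]; the one besides [x0] and [x] is
    the mate of [x]. *)
Let mate x z := [&& z \in Z, z != x & [exists b in B, [&& x0 \in b, x \in b & z \in b]]].

Let mateP x z : mate x z ->
  [/\ z \in Z, z != x & exists2 b, b \in B & [&& x0 \in b, x \in b & z \in b]].
Proof. by case/and3P => zZ zx /exists_inP. Qed.

Let Z_neq x : x \in Z -> x != x0.
Proof.
by rewrite inZ => /andP[_]; apply: contraNneq => ->; apply: gdd_mem_pblock GB _.
Qed.

Let mate_ex x : x \in Z -> exists z, mate x z.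
Proof.
move=> xZ; have := xZ; rewrite inZ => /andP[xY xx0].
have nG : pblock G x0 != pblock G x.
  by apply: contraNneq xx0 => ->; apply: gdd_mem_pblock GB _.
have [b bB /andP[x0b xb]] := gdd_joined GB (gdd_pblock GB x0) (gdd_pblock GB x) nG
  (gdd_mem_pblock GB x0) (gdd_mem_pblock GB x).
have := card_blockDY bB; rewrite (cardsD1 x0) (cardsD1 x) !inE x0b x0Y xb xY.
rewrite (Z_neq xZ) /= => -[] /eqP/cards1P[z zE].
have : z \in [set z] by rewrite inE.
rewrite -zE !inE => /and4P[zx zx0 zY zb]; exists z; apply/and3P; split=> //.
  rewrite inZ zY; apply: contraNN zx0 => zg; apply/eqP.
  by apply: (gdd_block_group GB bB (gdd_pblock GB x0)) => //; apply: gdd_mem_pblock GB _.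
by apply/exists_inP; exists b => //; rewrite x0b xb.
Qed.

Let mate_uniq x y z : x \in Z -> mate x y -> mate x z -> y = z.
Proof.
move=> xZ /mateP[yZ yx [b bB /and3P[x0b xb yb]]] /mateP[zZ zx [c cB /and3P[x0c xc zc]]].
have xx0 := Z_neq xZ.
have e : c = b by apply: (gdd_block_eq GB cB bB xx0).
rewrite {}e {c cB x0c xc} in zc; have := card_blockDY bB.
rewrite (cardsD1 x0) (cardsD1 x) !inE x0b x0Y xb xx0 /=.
move: (xZ) (yZ) (zZ); rewrite !inZ => /andP[-> _] /andP[yY _] /andP[zY _] [].
move=> /eqP/cards1P[w wE].
have : y \in [set w] by rewrite -wE !inE yx (Z_neq yZ) yY.
have : z \in [set w] by rewrite -wE !inE zx (Z_neq zZ) zY.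
by rewrite !inE => /eqP -> /eqP.
Qed.

Let mate_sym x z : x \in Z -> mate x z -> mate z x.
Proof.
move=> xZ /mateP[zZ zx [b bB /and3P[x0b xb zb]]]; apply/and3P; split=> //.
  by rewrite eq_sym.
by apply/exists_inP; exists b => //; rewrite x0b xb zb.
Qed.

Let tomate x := odflt x [pick z | mate x z].

Let tomateP x : x \in Z -> mate x (tomate x).
Proof.
move=> xZ; rewrite /tomate; case: pickP => //= none.
by have [z] := mate_ex xZ; rewrite none.
Qed.

Let tomate_matching : matching_on Z tomate.
Proof.
move=> x xZ; have mx := tomateP xZ; have [tZ tx _] := mateP mx; split=> //.
exact: mate_uniq tZ (tomateP tZ) (mate_sym xZ mx).
Qed.

Let tomate_partner : {in Z, forall x, tomate x != partner x}.
Proof.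
move=> x xZ; have [_ tx [b bB /and3P[_ xb tb]]] := mateP (tomateP xZ).
have := xZ; rewrite inZ => /andP[/partnerP/andP[px _] _].
apply: contraNneq tx => e; rewrite e in tb *; apply/eqP.
by apply: (gdd_block_group GB bB (gdd_pblock GB x)) => //; apply: gdd_mem_pblock GB _.
Qed.

Let not_alternates mates c :
  refuted_mates mates -> ~ alternates Z partner tomate mates c x0.
Proof.
case/and4P=> /eqP m5 /allP m10 mu rf [cu cZ c10 pc mc].
pose fi k := (nth (0, 0) mates k).1; pose si k := (nth (0, 0) mates k).2.
have inm k : k < 5 -> nth (0, 0) mates k \in mates by move=> k5; rewrite mem_nth ?m5.
have fi10 k : k < 5 -> fi k < 10 by move=> /inm/m10/andP[].
have si10 k : k < 5 -> si k < 10 by move=> /inm/m10/andP[].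
have cinZ i : i < 10 -> nth x0 c i \in Z by move=> i10; rewrite cZ ?mem_nth ?c10.
(* Each block through [x0] and a pair of mates has one point in [Y]; these points fix the order of
   [Y] in the numbering. *)
have /fin_all_exists[y yP] : forall k : 'I_5, exists y, (y \in Y) /\
    exists2 b, b \in B & [/\ x0 \in b, nth x0 c (fi k) \in b,
      nth x0 c (si k) \in b & y \in b].
  move=> k; have k5 := ltn_ord k.
  have [_ _ [b bB /and3P[x0b fb sb]]] := mateP (tomateP (cinZ _ (fi10 _ k5))).
  have /eqP/cards1P[z zE] := card_blockY bB.
  have : z \in b :&: Y by rewrite zE set11.
  rewrite inE => /andP[zb zY]; exists z; split=> //; exists b => //; split=> //.
  by rewrite -(mc _ (inm _ k5)).
have cneq i j : i < 10 -> j < 10 -> (nth x0 c i == nth x0 c j) = (i == j).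
  by move=> i10 j10; rewrite nth_uniq ?c10.
have [fu nfs su] : [/\ uniq (unzip1 mates),
    forall k l, k < 5 -> l < 5 -> fi k != si l & uniq (unzip2 mates)].
  move: mu; rewrite cat_uniq => /and3P[fu /hasPn fs su]; split=> // k l k5 l5.
  have /fs : si l \in unzip2 mates by apply/mapP; exists (nth (0, 0) mates l); rewrite ?inm.
  apply: contraNneq => <-; apply/mapP.
  by exists (nth (0, 0) mates k); rewrite ?inm.
(* If two pairs of mates gave the same point of [Y], their blocks would share it together with [x0],
   hence coincide, and this block would contain [x0], one pair and a point of the other, four points
   off [Y]. *)
have y_inj : injective y.
  move=> k l ykl; apply/eqP; apply: contraTT isT => kl.
  have [yY [b bB [x0b kb k'b yb]]] := yP k; have [_ [d dB [x0d ld _ yd]]] := yP l.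
  have y0 : x0 != y k by apply: contraNneq x0Y => ->.
  have e : d = b by apply: (gdd_block_eq GB dB bB y0); rewrite // ykl.
  rewrite {}e {dB x0d yd} in ld.
  suff : 3 < #|b :\: Y| by rewrite card_blockDY.
  set L := [:: x0; nth x0 c (fi k); nth x0 c (si k); nth x0 c (fi l)].
  have Lu : uniq L.
    rewrite /= !inE !negb_or ![x0 == _]eq_sym !Z_neq ?cinZ ?fi10 ?si10 //.
    rewrite !cneq ?fi10 ?si10 // nfs // [si k == _]eq_sym nfs // !andbT /=.
    by rewrite /fi -!(nth_map _ 0 (@fst _ _)) ?m5 // nth_uniq ?size_map ?m5.
  rewrite -[4]/(size L) -(card_uniqP Lu); apply: subset_leq_card.
  apply/subsetP => x; rewrite !inE; have zY i : i < 10 -> nth x0 c i \notin Y.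
    by move/cinZ; rewrite inZ => /andP[].
  by case/or4P => /eqP ->; rewrite ?x0Y ?zY ?fi10 ?si10.
pose ys := [seq y k | k <- enum 'I_5].
have ys_nth k (k5 : k < 5) : nth x0 ys k = y (Ordinal k5).
  rewrite (nth_map (Ordinal k5)) ?size_enum_ord //; congr y; apply: val_inj.
  by rewrite /= nth_enum_ord.
have ysu : uniq ys by rewrite (map_inj_uniq y_inj) enum_uniq.
have ys5 : size ys = 5 by rewrite size_map size_enum_ord.
have ysY x : x \in ys -> x \in Y by case/mapP => k _ ->; have [] := yP k.
have ysE : ys =i Y by apply/subset_cardP; [rewrite Y5 (card_uniqP ysu) | apply/subsetP].
have /andP[px npx] := partnerP x0Y.
have pxY : partner x0 \notin Y.
  apply: contraNN x0Y => pY.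
  by rewrite -(gdd_def_pblock GB YG pY) (pb_eq px) (gdd_mem_pblock GB).
pose pts := [:: x0, partner x0 & c ++ ys].
have ptsu : uniq pts.
  have nc x : x \in pblock G x0 -> x \notin c.
    by move=> xg; apply/negP => /cZ; rewrite inZ xg andbF.
  rewrite /= inE negb_or [x0 == _]eq_sym npx !mem_cat !negb_or !ysE x0Y pxY !nc //.
    rewrite cat_uniq cu ysu /= ?andbT; apply/hasPn => x /ysY xY.
    by apply/negP => /cZ; rewrite inZ xY.
  exact: gdd_mem_pblock GB _.
have pts17 : size pts = #|X| by rewrite /= size_cat c10 ys5 X17.
have ptc i : i < 10 -> nth x0 pts i.+2 = nth x0 c i by move=> i10; rewrite /= nth_cat c10 i10.
have pty i : nth x0 pts (12 + i) = nth x0 ys i.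
  by rewrite /= nth_cat c10 ltnNge leq_addr /= -[10 + i]addnC addnK.
have pt_notY i : i < 12 -> nth x0 pts i \notin Y.
  by case: i => [|[|i]] // i12; rewrite ptc //; have := cinZ i i12; rewrite inZ => /andP[].
apply: (@refute_gdd _ _ _ x0 pts GB ptsu pts17 21 cross_2x6_5x1 (ok_2x6_5x1 mates)); last by rewrite X17.
- move=> b bB; rewrite /ok_2x6_5x1; apply/and3P; split.
  + apply/allP => i; rewrite mem_iota /= => i6.
    apply: (at_most_one_bits (x0 := x0) GB ptsu pts17 bB (gdd_pblock GB (nth x0 pts (2 * i)))).
    * by rewrite /= X17 !andbT; case: i i6 => [|[|[|[|[|[]]]]]].
    * by rewrite /= inE andbT neq_ltn leqnn.
    move=> j; rewrite !inE => /orP[] /eqP ->; first exact: gdd_mem_pblock GB _.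
    case: i i6 => [|i] // i5; rewrite (_ : 2 * i.+1 = (2 * i).+2) ?mulnS //.
    have i10 : (2 * i).+1 < 10 by case: i i5 => [|[|[|[|[]]]]].
    rewrite (ptc _ i10) (ptc _ (ltnW i10)) -pc //.
    have : nth x0 c (2 * i) \in Z by rewrite cinZ // ltnW.
    by rewrite inZ => /andP[/partnerP/andP[]].
  + rewrite (count_bits x0 pts17) ?X17 //.
    have -> : [seq nth x0 pts i | i <- iota 12 5] = ys.
      apply: (@eq_from_nth _ x0) => [|i]; rewrite size_map size_iota // => i5.
      by rewrite (nth_map 0) ?size_iota // nth_iota // pty.
    rewrite -size_filter -(card_uniqP (filter_uniq _ ysu)) -(card_blockY bB); apply/eqP.
    by apply: eq_card => x; rewrite [RHS]inE -ysE; apply: mem_filter.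
  apply/allP => k; rewrite mem_iota /= => k5.
  have [_ [d dB [x0d fd sd yd]]] := yP (Ordinal k5).
  apply: (collinear_rule_bits (x0 := x0) GB ptsu pts17 bB dB).
  + rewrite -/(fi k) -/(si k) /= X17 !ltnS andbT.
    by rewrite !(leq_trans (ltnW (fi10 k k5))) ?(leq_trans (ltnW (si10 k k5))).
  + rewrite -/(fi k) -/(si k) /= !inE !negb_or !eqSS nfs //= andbT.
    by rewrite !(ltn_eqF (leq_trans _ (leq_addr k 10))) ?fi10 ?si10.
  have f_d : nth x0 pts (fi k).+2 \in d by rewrite ptc ?fi10.
  have s_d : nth x0 pts (si k).+2 \in d by rewrite ptc ?si10.
  have y_d : nth x0 pts (12 + k) \in d by rewrite pty ys_nth.
  by move=> i; rewrite !inE => /or4P[] /eqP ->.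
apply/allP => -[i j] /allpairsP[[i' j'] [i12 j5 [-> ->]]].
move: i12 j5; rewrite !mem_iota => /= i12 /andP[j12 j17].
rewrite X17 j17 (ltn_trans i12) //=.
have -> : pblock G (nth x0 pts j') = Y.
  apply: (gdd_def_pblock GB YG); apply: ysY; rewrite -(subnKC j12) pty mem_nth // ys5.
  by rewrite ltn_subLR.
exact: pb_neqY (pt_notY _ i12).
Qed.

Lemma not_type_2x6_5x1 : False.
Proof.
have [c [alt|alt]] := two_matchings partner_matching tomate_matching tomate_partner card_Z x0.
  exact: not_alternates five_cycle_refuted alt.
exact: not_alternates two_three_cycles_refuted alt.
Qed.

End Type_2x6_5x1.

Lemma no_gdd_2x6_5x1 (X : finType) (G B : {set {set X}}) : is_gdd 4 G B ->
  perm_eq (group_sizes G) (5 :: nseq 6 2) -> False.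
Proof.
move=> GB Gs; have X17 : #|X| = 17 by rewrite (gdd_card GB Gs).
have : 5 \in group_sizes G by rewrite (perm_mem Gs) mem_head.
case/mapP => Y YG /esym Y5.
have rest : perm_eq [seq #|g : {set X}| | g <- rem Y (enum G)] (nseq 6 2).
  by move: Gs; rewrite /group_sizes (permPl (perm_map _ (perm_to_rem YG))) /= Y5 perm_cons.
have card2 : {in G, forall g, g != Y -> #|g| = 2}.
  move=> g gG gY; have : #|g| \in [seq #|g : {set X}| | g <- rem Y (enum G)].
    by apply/mapP; exists g; rewrite // (mem_rem_uniq _ (enum_uniq _)) inE gY mem_enum.
  by rewrite (perm_mem rest) mem_nseq => /eqP.
have [x xY] : exists x, x \notin Y.
  have : 0 < #|~: Y| by rewrite cardsCs setCK X17 Y5.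
  by case/card_gt0P => x; rewrite inE; exists x.
rewrite mem_enum in YG; exact: (not_type_2x6_5x1 GB YG Y5 X17 card2 xY).
Qed.

(** * Types 2^4 and 6^4 *)

Section Transversal.

Variables (n : nat) (X : finType) (G B : {set {set X}}).
Hypotheses (GB : is_gdd 4 G B) (Gn : perm_eq (group_sizes G) (nseq 4 n)).

Definition grp (i : 'I_4) : {set X} := nth set0 (enum G) i.

Lemma size_enum_td : size (enum G) = 4.
Proof. by have := perm_size Gn; rewrite size_map size_nseq. Qed.

Lemma grp_mem i : grp i \in G.
Proof. by rewrite -mem_enum mem_nth // size_enum_td. Qed.

Lemma grp_inj : injective grp.
Proof.
move=> i j /eqP; rewrite nth_uniq ?size_enum_td ?enum_uniq // => /eqP.
exact: val_inj.
Qed.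

Lemma card_grp i : #|grp i| = n.
Proof.
have : #|grp i| \in group_sizes G by apply/mapP; exists (grp i); rewrite ?mem_enum ?grp_mem.
by rewrite (perm_mem Gn) mem_nseq => /eqP.
Qed.

Lemma grp_cover x : exists i, x \in grp i.
Proof.
have gG := gdd_pblock GB x; rewrite -mem_enum in gG.
have i4 : index (pblock G x) (enum G) < 4 by rewrite -size_enum_td index_mem.
by exists (Ordinal i4); rewrite /grp nth_index // (gdd_mem_pblock GB).
Qed.

Lemma grp_eq x i j : x \in grp i -> x \in grp j -> i = j.
Proof.
move=> xi xj; apply: grp_inj.
by rewrite -(gdd_def_pblock GB (grp_mem i) xi) (gdd_def_pblock GB (grp_mem j) xj).
Qed.

Lemma card_by_grp (S : {set X}) : #|S| = \sum_i #|S :&: grp i|.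
Proof.
transitivity (\sum_(x in S) \sum_i (x \in grp i : nat)).
  rewrite -sum1_card; apply: eq_bigr => x _; have [i xi] := grp_cover x.
  rewrite (bigD1 i) //= xi big1 // => j ji.
  by apply/eqP; rewrite eqb0; apply: contraNN ji => xj; rewrite (grp_eq xi xj).
rewrite exchange_big; apply: eq_bigr => i _ /=.
rewrite -sum1_card big_mkcond [RHS]big_mkcond /=; apply: eq_bigr => x _.
by rewrite inE; case: (x \in S); case: (x \in grp i).
Qed.

(** Four numbers at most 1 add up to the block size 4, so each equals 1. *)
Lemma block_grp b i : b \in B -> #|b :&: grp i| = 1.
Proof.
move=> bB; have le j : true -> #|b :&: grp j| <= 1 ?= iff (#|b :&: grp j| == 1).
  by move=> _; apply/leqif_eq/(gdd_transverse GB bB (grp_mem j)).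
have [_] := leqif_sum le; rewrite -card_by_grp (gdd_blocks GB bB) sum1_card card_ord.
by move/esym/forallP/(_ i)/eqP.
Qed.

Lemma block_point b i : b \in B -> exists x, (x \in b) && (x \in grp i).
Proof.
move=> bB; have /eqP/cards1P[x xE] := block_grp i bB.
by exists x; have := set11 x; rewrite -xE inE.
Qed.

Lemma grp_joined i j x y : i != j -> x \in grp i -> y \in grp j ->
  exists2 b, b \in B & (x \in b) && (y \in b).
Proof.
move=> ij; apply: (gdd_joined GB (grp_mem i) (grp_mem j)).
by apply: contra ij => /eqP/grp_inj ->.
Qed.

Lemma grp_block_eq b i x y :
  b \in B -> x \in b -> y \in b -> x \in grp i -> y \in grp i -> x = y.
Proof. by move=> bB; apply: (gdd_block_group GB bB (grp_mem i)). Qed.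

End Transversal.

Arguments grp {X} G i.

(** Let [b], [c], [d] join a to y, a to y' and a' to y, where a, a' and y, y' form two groups. Both
    [c] and [d] already meet [b] there, so in the remaining two groups both avoid the point of [b]
    and contain the other one. They share two points and coincide, but then a and a' lie on one
    block. *)
Lemma no_gdd_2x4 (X : finType) (G B : {set {set X}}) : is_gdd 4 G B ->
  perm_eq (group_sizes G) (nseq 4 2) -> False.
Proof.
move=> GB G2.
pose o k : 'I_4 := inord k.
have neqo i j : i < 4 -> j < 4 -> i != j -> o i != o j.
  by move=> i4 j4; apply: contra => /eqP/(congr1 val); rewrite /= !inordK // => ->.
have pick2 i x y z : x \in grp G i -> y \in grp G i -> z \in grp G i ->
    y != x -> z != x -> y = z.
  move=> xi yi zi yx zx; have := card_grp G2 i.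
  rewrite (cardsD1 x) xi => -[] /eqP/cards1P[w wE].
  have : y \in [set w] by rewrite -wE !inE yx.
  have : z \in [set w] by rewrite -wE !inE zx.
  by rewrite !inE => /eqP -> /eqP.
have two i : exists x y, [/\ x \in grp G i, y \in grp G i & x != y].
  by have := card_grp G2 i => /eqP/cards2P[x [y [xy ->]]]; exists x, y; rewrite !inE !eqxx orbT.
have [a [a' [ag a'g aa']]] := two (o 0); have [y [y' [yg y'g yy']]] := two (o 1).
have [b bB /andP[ab yb]] := grp_joined GB G2 (neqo 0 1 isT isT isT) ag yg.
have [c cB /andP[ac yc]] := grp_joined GB G2 (neqo 0 1 isT isT isT) ag y'g.
have [d dB /andP[ad yd]] := grp_joined GB G2 (neqo 0 1 isT isT isT) a'g yg.
have cb : c != b.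
  by apply: contraNneq yy' => e; rewrite e in yc; apply/eqP/(grp_block_eq GB G2 bB yb yc yg).
have db : d != b.
  by apply: contraNneq aa' => e; rewrite e in ad; apply/eqP/(grp_block_eq GB G2 bB ab ad ag).
have other k : 1 < k < 4 -> exists z, [/\ z \in grp G (o k), z \in c & z \in d].
  case/andP=> k1 k4.
  have [z /andP[zb zg]] := block_point GB G2 (o k) bB.
  have [w /andP[wc wg]] := block_point GB G2 (o k) cB.
  have [u /andP[ud ug]] := block_point GB G2 (o k) dB.
  have ne x i : x \in grp G (o i) -> i < 2 -> z != x.
    move=> xi i2; apply: contraNneq (neqo k i k4 _ _) => [zx||].
    - by rewrite zx in zg; rewrite (grp_eq GB G2 xi zg).
    - by apply: ltn_trans i2 _.
    - by rewrite neq_ltn orbC (leq_trans i2).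
  have wz : w != z.
    apply: contraNneq cb => e; rewrite e in wc; apply/eqP.
    exact: (gdd_block_eq GB cB bB (ne a 0 ag isT)).
  have uz : u != z.
    apply: contraNneq db => e; rewrite e in ud; apply/eqP.
    exact: (gdd_block_eq GB dB bB (ne y 1 yg isT)).
  by exists w; rewrite wg wc (pick2 _ _ _ _ zg wg ug wz uz).
have [z [zg zc zd]] := other 2 isT; have [w [wg wc wd]] := other 3 isT.
have zw : z != w.
  by apply: contraNneq (neqo 2 3 isT isT isT) => e; rewrite e in zg; rewrite (grp_eq GB G2 zg wg).
have e : c = d by apply: (gdd_block_eq GB cB dB zw).
rewrite -e in ad; move/eqP: aa'; apply; exact: (grp_block_eq GB G2 cB ac ad ag).
Qed.

(** * Even sets from the kernel of the incidence matrix *)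

Section EvenSets.

Variables (X : finType) (G B : {set {set X}}).
Hypotheses (GB : is_gdd 4 G B) (G6 : perm_eq (group_sizes G) (nseq 4 6)).

Definition even_set (S : {set X}) : bool := [forall b in B, ~~ odd #|b :&: S|].

Definition nontrivial_set (S : {set X}) : bool :=
  even_set S && [exists i, 0 < #|S :&: grp G i| < 6].

Lemma sum_through i x (S : {set X}) : x \in grp G i ->
  \sum_(b in B | x \in b) #|b :&: (S :\: grp G i)| = #|S :\: grp G i|.
Proof.
move=> xi; apply: (gdd_sum_through GB (grp_mem G6 i) xi).
by rewrite disjoints_subset setDE subsetIr.
Qed.

(** Each block through [x] has one point in any fixed other group, and each of the six points there
    is on one such block. *)
Lemma card_through x : #|[set b in B | x \in b]| = 6.
Proof.
have [i xi] := grp_cover GB G6 x; pose j := lift i ord0; have ij := neq_lift i ord0.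
rewrite -/j in ij.
rewrite -[6](card_grp G6 j).
have <- : grp G j :\: grp G i = grp G j.
  apply/setDidPl; rewrite disjoint_sym -setI_eq0; apply/eqP/setP => y; rewrite !inE.
  by apply: contraNF ij => /andP[yi yj]; rewrite (grp_eq GB G6 yi yj).
rewrite -(sum_through _ xi) -sum1_card.
rewrite (eq_bigl (fun b => (b \in B) && (x \in b))); last by move=> b; rewrite inE.
apply: eq_bigr => b /andP[bB xb].
rewrite -(block_grp GB G6 j bB); congr #|pred_of_set _|; apply/setP => y; rewrite !inE.
have [yj|] := boolP (y \in grp G j); last by rewrite !andbF.
suff yi : y \notin grp G i by rewrite yi !andbT.
by apply: contra ij => yi; rewrite (grp_eq GB G6 yi yj).
Qed.

Lemma card_blocks : #|B| = 36.
Proof.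
transitivity (\sum_(b in B) \sum_(x in grp G ord0) (x \in b : nat)).
  rewrite -sum1_card; apply: eq_bigr => b bB.
  rewrite -[LHS](block_grp GB G6 ord0 bB) -sum1_card big_mkcond [RHS]big_mkcond /=.
  apply: eq_bigr => x _.
  by rewrite inE andbC; case: (x \in grp G ord0); case: (x \in b).
rewrite exchange_big /= (eq_bigr (fun=> 6)) ?sum_nat_const ?(card_grp G6) // => x _.
rewrite -(card_through x) -sum1_card big_mkcond [RHS]big_mkcond /=.
by apply: eq_bigr => b _; rewrite inE; case: (b \in B); case: (x \in b).
Qed.

Lemma natr_F2_eq0 m : ((m%:R : 'F_2) == 0)%R = ~~ odd m.
Proof. by rewrite -(@dvdn_pcharf _ 2) ?dvdn2 ?pchar_Fp. Qed.

Lemma F2_natr (c : 'F_2) : c = ((c != 0%R)%:R)%R.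
Proof. by apply: val_inj; case: c => -[|[|//]]. Qed.

Local Open Scope ring_scope.

Definition incidence : 'M['F_2]_(#|X|, #|B|) :=
  \matrix_(i, j) (enum_val i \in (enum_val j : {set X}))%:R.

(** The entry at (x, y) is the number of blocks through both points modulo 2: six on the diagonal,
    none for distinct points of a group, one across groups. So it only tells whether the groups
    differ, and the matrix factors through dimension 4. *)
Lemma incidence_gram :
  incidence *m incidence^T =
  (\matrix_(i < #|X|, k < 4) (enum_val i \in grp G k)%:R) *m
  (\matrix_(k < 4, j < #|X|) (enum_val j \notin grp G k)%:R).
Proof.
apply/matrixP => i j; rewrite !mxE.
set x := enum_val i; set y := enum_val j.
have [k xk] := grp_cover GB G6 x.
rewrite [RHS](bigD1 k) //= [X in _ = _ + X]big1 ?addr0; last first.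
  move=> l lk; rewrite !mxE (_ : x \in grp G l = false) ?mul0r //.
  by apply: contraNF lk => xl; rewrite (grp_eq GB G6 xl xk).
rewrite !mxE -/x xk mul1r -/y.
transitivity (#|[set b in B | (x \in b) && (y \in b)]|%:R : 'F_2).
  rewrite -[in RHS]sum1_card natr_sum [RHS]big_mkcond /=.
  transitivity (\sum_(b in B) ((x \in b)%:R * (y \in b)%:R : 'F_2)).
    by rewrite [RHS]big_enum_val; apply: eq_bigr => l _; rewrite !mxE.
  rewrite big_mkcond; apply: eq_bigr => b _; rewrite inE.
  by case: (b \in B); case: (x \in b); case: (y \in b); rewrite ?mulr0 ?mul0r ?mulr1.
have [yk|yk] := boolP (y \in grp G k); last first.
  have [l yl] := grp_cover GB G6 y.
  have kl : grp G k != grp G l by apply: contraNneq yk => ->.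
  by rewrite (gdd_pairs GB (grp_mem G6 k) (grp_mem G6 l) kl xk yl).
apply/eqP; rewrite natr_F2_eq0; have [<-|xy] := eqVneq x y.
  rewrite (_ : [set b in B | _] = [set b in B | x \in b]) ?card_through //.
  by apply/setP => b; rewrite !inE andbb.
rewrite (_ : [set b in B | _] = set0) ?cards0 //; apply/setP => b; rewrite !inE.
by apply: contraNF xy => /and3P[bB xb yb]; rewrite (grp_block_eq GB G6 bB xb yb xk yk).
Qed.

(** Sylvester's inequality: twice the rank is at most 36 + 4. *)
Lemma rank_incidence : (\rank incidence <= 20)%N.
Proof.
have := mxrank_mul_min incidence incidence^T.
rewrite incidence_gram mxrank_tr => le.
have := leq_trans le (leq_trans (mxrankM_maxl _ _) (rank_leq_col _)).
move: (\rank incidence) => r; rewrite card_blocks.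
by rewrite leq_subLR addnn -[(36 + 4)%N]/(20.*2)%N leq_double.
Qed.

Lemma card_points : #|X| = 24%N.
Proof. by rewrite (gdd_card GB G6). Qed.

(** Even sets are the left kernel of the incidence matrix, of dimension at least 24 - 20 = 4. Three
    further linear conditions still leave a nonzero [S], which can be required to miss a chosen
    point in each of the first three groups. If [S] meets one of these groups, it splits it;
    otherwise it lies in the last group. *)
Lemma nontrivial_set_exists : exists S, nontrivial_set S.
Proof.
have /fin_all_exists[pt ptP] : forall k : 'I_4, exists x, x \in grp G k.
  by move=> k; apply/card_gt0P; rewrite (card_grp G6).
pose C : 'M['F_2]_(#|X|, 3) := \matrix_(i, k) (enum_val i == pt (widen_ord (leqnSn 3) k))%:R.
have : kermx (row_mx incidence C) != 0.
  rewrite -mxrank_eq0 mxrank_ker -lt0n subn_gt0.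
  (* As a sum of two products, the matrix has rank at most 20 + 3 < 24. *)
  have -> : row_mx incidence C = incidence *m row_mx 1%:M 0 + C *m row_mx 0 1%:M.
    by rewrite !mul_mx_row !mulmx1 !mulmx0 add_row_mx addr0 add0r.
  apply: leq_ltn_trans (mxrank_add _ _) _.
  apply: (@leq_ltn_trans (20 + 3)%N); last by rewrite card_points.
  apply: leq_add.
    exact: leq_trans (mxrankM_maxl _ _) rank_incidence.
  exact: leq_trans (mxrankM_maxl _ _) (rank_leq_col _).
case/rowV0Pn => v /sub_kermxP/eqP; rewrite mul_mx_row row_mx_eq0.
case/andP=> /eqP vA /eqP vC v0.
pose S := [set x | v 0 (enum_rank x) != 0].
have sumS (A : pred X) :
    \sum_i v 0 i * (A (enum_val i))%:R = #|[set x in S | A x]|%:R.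
  rewrite -[in RHS]sum1_card natr_sum (reindex _ (onW_bij _ (@enum_rank_bij X))) /= [RHS]big_mkcond.
  apply: eq_bigr => x _; rewrite enum_rankK !inE {1}[v 0 _]F2_natr.
  by case: (v 0 _ != 0); case: (A x); rewrite ?mulr0 ?mul0r ?mulr1.
have evS : even_set S.
  apply/forall_inP => b bB; rewrite -natr_F2_eq0.
  have := congr1 (fun M : 'rV_#|B| => M 0 (enum_rank_in bB b)) vA.
  rewrite !mxE (eq_bigr (fun i => v 0 i * (enum_val i \in b)%:R)); last first.
    by move=> i _; rewrite !mxE enum_rankK_in.
  by rewrite (sumS (mem b)) setIC => <-; apply/eqP.
have ptS (k : 'I_4) : (k < 3)%N -> pt k \notin S.
  move=> k3; have := congr1 (fun M : 'rV_3 => M 0 (Ordinal k3)) vC.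
  rewrite !mxE (eq_bigr (fun i => v 0 i * (enum_val i == pt k)%:R)); last first.
    by move=> i _; rewrite !mxE; congr (_ * (_ == pt _)%:R); apply: val_inj.
  rewrite (sumS (pred1 (pt k))) => /eqP; rewrite natr_F2_eq0; apply: contraNN => pS.
  rewrite (_ : [set x in S | _] = [set pt k]) ?cards1 //.
  apply/setP => x; rewrite !inE /=; have [->|] := eqVneq x (pt k); rewrite ?andbF //.
  by rewrite andbT; move: pS; rewrite inE.
exists S; rewrite /nontrivial_set evS /=.
have lt6 k x : x \in grp G k -> x \notin S -> (#|S :&: grp G k| < 6)%N.
  move=> xk xS; rewrite -(card_grp G6 k); apply: proper_card.
  by rewrite properE subsetIr; apply/subsetPn; exists x; rewrite // inE (negPf xS).
have [x xS] : exists x, x \in S.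
  apply/set0Pn; apply: contraNneq v0 => S0; apply/eqP/rowP => i; rewrite mxE.
  by apply/eqP; have := in_set0 (enum_val i); rewrite -S0 inE enum_valK => /negbFE.
apply/existsP.
have [/existsP[k /andP[k3 Sk]]|small] :=
  boolP [exists k : 'I_4, (k < 3)%N && (0 < #|S :&: grp G k|)%N].
  by exists k; rewrite Sk; apply: lt6 (ptP k) (ptS k k3).
have ge3 y (l : 'I_4) : y \in S -> y \in grp G l -> (2 < l)%N.
  move=> yS yl; rewrite ltnNge; apply: contra small => l3; apply/existsP; exists l.
  by rewrite ltnS l3; apply/card_gt0P; exists y; rewrite inE yS.
have [k xk] := grp_cover GB G6 x; exists k.
have -> /= : (0 < #|S :&: grp G k|)%N by apply/card_gt0P; exists x; rewrite inE xS.
(* Now [S] lies in the last group. Were it the whole group, each block would meet it in one point,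
   an odd number. *)
have [/subsetP gS|/subsetPn[y yk yS]] := boolP (grp G k \subset S); last exact: lt6 yk yS.
have [b] : exists b, b \in [set b in B | x \in b] by apply/card_gt0P; rewrite card_through.
rewrite inE => /andP[bB _]; have /forall_inP/(_ b bB) := evS.
suff -> : b :&: S = b :&: grp G k by rewrite (block_grp GB G6).
apply/setP => y; rewrite !in_setI; congr (_ && _); apply/idP/idP => [yS|/gS //].
have [l yl] := grp_cover GB G6 y; suff -> : k = l by [].
apply: val_inj; have := ge3 _ _ xS xk; have := ge3 _ _ yS yl.
by move: (ltn_ord k) (ltn_ord l) => /=; lia.
Qed.

End EvenSets.

(** * A smallest nontrivial even set has two points in each group *)

Section Stinson.

Variables (X : finType) (G B : {set {set X}}).
Hypotheses (GB : is_gdd 4 G B) (G6 : perm_eq (group_sizes G) (nseq 4 6)).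

Local Notation grp := (grp G).

Lemma card_block_even b x i (S : {set X}) : b \in B -> x \in b -> x \in grp i ->
  #|b :&: S| = (x \in S) + #|b :&: (S :\: grp i)|.
Proof.
move=> bB xb xi; rewrite -(cardsID (grp i) (b :&: S)) -setIDA; congr (_ + _).
have -> : b :&: S :&: grp i = if x \in S then [set x] else set0.
  apply/setP => y; apply/idP/idP => [/setIP[/setIP[yb yS] yi]|].
    by rewrite (grp_block_eq GB G6 bB xb yb xi yi) yS set11.
  by case: ifP => xS; rewrite ?inE // => /eqP ->; rewrite xb xS xi.
by case: ifP => _; rewrite ?cards1 ?cards0.
Qed.

(* The six blocks through x all meet S minus x in the same parity, and they
   partition the points of S outside the group of x. *)
Lemma even_set_sum (S : {set X}) x i : even_set B S -> x \in grp i ->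
  #|S :\: grp i| =
  6 * (x \in S) + (\sum_(b in B | x \in b) #|b :&: (S :\: grp i)|./2).*2.
Proof.
move=> /forall_inP evS xi; rewrite -(sum_through GB G6 S xi).
transitivity (\sum_(b in B | x \in b) ((x \in S) + #|b :&: (S :\: grp i)|./2.*2)).
  apply: eq_bigr => b /andP[bB xb]; rewrite -[LHS]odd_double_half; congr (_ + _).
  have := evS b bB; rewrite (card_block_even S bB xb xi) oddD oddb.
  by case: (x \in S); case: (odd _).
rewrite big_split /=; congr (_ + _).
  rewrite sum_nat_const -(card_through GB G6 x); congr (_ * _).
  by apply: eq_card => b; rewrite !inE.
by rewrite -!muln2 big_distrl /=; apply: eq_bigr => b _; rewrite muln2.
Qed.

(** A union of two groups meets every block in two points, so this symmetric difference preserves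
    evenness. It bounds the sizes that a smallest set can have. *)
Definition flip (i j : 'I_4) (S : {set X}) : {set X} :=
  [set x | (x \in S) (+) (x \in grp i :|: grp j)].

Lemma card_flip (A S : {set X}) i j :
  #|A :&: flip i j S| + 2 * #|A :&: S :&: (grp i :|: grp j)| =
  #|A :&: S| + #|A :&: (grp i :|: grp j)|.
Proof.
set C := grp i :|: grp j.
rewrite -(cardsID C (A :&: flip i j S)) -[in RHS](cardsID C (A :&: S)).
rewrite -[in X in _ = _ + X](cardsID S (A :&: C)).
have -> : A :&: flip i j S :&: C = A :&: C :\: S.
  apply/setP => x; rewrite !inE.
  by case: (x \in A); case: (x \in S); case: (x \in grp i); case: (x \in grp j).
have -> : A :&: flip i j S :\: C = A :&: S :\: C.
  apply/setP => x; rewrite !inE.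
  by case: (x \in A); case: (x \in S); case: (x \in grp i); case: (x \in grp j).
have -> : A :&: C :&: S = A :&: S :&: C by rewrite setIAC.
by lia.
Qed.

Lemma card_setI_grpU (A : {set X}) i j : i != j ->
  #|A :&: (grp i :|: grp j)| = #|A :&: grp i| + #|A :&: grp j|.
Proof.
move=> ij; rewrite setIUr cardsU.
suff -> : A :&: grp i :&: (A :&: grp j) = set0 by rewrite cards0 subn0.
apply/setP => x; rewrite !inE.
by apply: contraNF ij => /andP[/andP[_ xi] /andP[_ xj]]; rewrite (grp_eq GB G6 xi xj).
Qed.

Lemma flip_even i j S : i != j -> even_set B S -> even_set B (flip i j S).
Proof.
move=> ij /forall_inP evS; apply/forall_inP => b bB.
have := card_flip b S i j; rewrite (card_setI_grpU b ij) !(block_grp GB G6 _ bB).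
move/(congr1 odd); rewrite mul2n !oddD odd_double /= !addbF => ->.
exact: evS.
Qed.

Lemma flip_nontrivial i j S : i != j ->
  nontrivial_set G B S -> nontrivial_set G B (flip i j S).
Proof.
move=> ij /andP[evS /existsP[k Sk]]; rewrite /nontrivial_set flip_even //=.
apply/existsP; exists k.
have := card_flip (grp k) S i j; rewrite !(card_setI_grpU _ ij) ![_ :&: grp k]setIC.
have g l : grp k :&: grp l = if k == l then grp k else set0.
  case: eqP => [<-|/eqP kl]; first by rewrite setIid.
  apply/setP => x; rewrite !inE.
  by apply: contraNF kl => /andP[xk xl]; rewrite (grp_eq GB G6 xk xl).
have gS l : grp k :&: S :&: grp l = if k == l then grp k :&: S else set0.
  by rewrite -setIAC g; case: ifP => // _; rewrite set0I.
rewrite !g !gS; case: (eqVneq k i) => [ki|_]; case: (eqVneq k j) => [kj|_];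
  rewrite ?cards0 ?(card_grp G6) ?[_ :&: grp k]setIC; move: Sk; rewrite setIC => Sk.
- by rewrite -ki -kj eqxx in ij.
all: by lia.
Qed.

(** Each of the six blocks through [x] contains an odd number of the six points of [S] off the group
    of [x], hence exactly one. *)
Lemma even_set_meet2 S i x b : even_set B S -> #|S :\: grp i| = 6 ->
  x \in S -> x \in grp i -> b \in B -> x \in b -> #|b :&: S| = 2.
Proof.
move=> evS S6 xS xi bB xb; have := even_set_sum evS xi.
rewrite S6 xS muln1 -{1}[6]addn0 => /eqP; rewrite eqn_add2l eq_sym double_eq0 sum_nat_eq0.
move/forall_inP/(_ b); rewrite bB xb => /(_ isT)/eqP half0.
have /forall_inP/(_ b bB) := evS; rewrite (card_block_even S bB xb xi) xS.
by move: half0; case: #|_| => [|[|[|m]]].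
Qed.

(** Excludes sizes 4, 2, 2, 2, with the 4 in group [i]. For a point of [S] in group [j], the eight
    points of [S] off that group lie on six blocks, an odd number on each, so some block has three
    of them and is contained in [S]. But at its point in group [i], a block must meet [S] in just
    two points. *)
Lemma even_set_not4222 S i j : even_set B S -> #|S :\: grp i| = 6 ->
  #|S :\: grp j| = 8 -> #|S :&: grp j| > 0 -> False.
Proof.
move=> evS Si Sj /card_gt0P[y /setIP[yS yj]].
have := even_set_sum evS yj; rewrite Sj yS muln1 -[8]/(6 + 1.*2) => /eqP.
rewrite eqn_add2l => /eqP/double_inj sum1.
have [/existsP[b /andP[/andP[bB yb] half]]|none] :=
  boolP [exists b, (b \in B) && (y \in b) && (0 < #|b :&: (S :\: grp j)|./2)].
  have bS : b \subset S.
    apply/setIidPl/eqP; rewrite eqEcard subsetIl (gdd_blocks GB bB).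
    have /forall_inP/(_ b bB) := evS; rewrite (card_block_even S bB yb yj) yS.
    by move: half; case: #|_| => [|[|[|m]]].
  have [x /andP[xb xi]] := block_point GB G6 i bB.
  have := even_set_meet2 evS Si (subsetP bS _ xb) xi bB xb.
  by rewrite (setIidPl bS) (gdd_blocks GB bB).
move: sum1; rewrite big1 // => b bP; apply/eqP; rewrite -leqn0 leqNgt.
by apply: contra none => half; apply/existsP; exists b; rewrite bP.
Qed.

(** The arguments are the numbers of points of [S] in the four groups. The premises come, in order,
    from minimality under [flip], from the parity and the lower bound contained in [even_set_sum],
    and from nontriviality. *)
Definition even_set_profile (a b c d : nat) : bool :=
  [&& a + b <= 6, a + c <= 6, a + d <= 6, b + c <= 6, b + d <= 6 & c + d <= 6] ==>
  [&& ~~ odd (b + c + d), ~~ odd (a + c + d), ~~ odd (a + b + d) & ~~ odd (a + b + c)] ==>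
  [&& (0 < a) ==> (6 <= b + c + d), (0 < b) ==> (6 <= a + c + d),
      (0 < c) ==> (6 <= a + b + d) & (0 < d) ==> (6 <= a + b + c)] ==>
  [|| 0 < a < 6, 0 < b < 6, 0 < c < 6 | 0 < d < 6] ==>
  [|| [&& a == 2, b == 2, c == 2 & d == 2], [&& a == 4, b == 2, c == 2 & d == 2],
      [&& a == 2, b == 4, c == 2 & d == 2], [&& a == 2, b == 2, c == 4 & d == 2] |
      [&& a == 2, b == 2, c == 2 & d == 4]].

Lemma even_set_profileT (a b c d : nat) : a <= 6 -> b <= 6 -> c <= 6 -> d <= 6 ->
  even_set_profile a b c d.
Proof.
have /allP h : all (fun a => all (fun b => all (fun c => all (even_set_profile a b c)
  (iota 0 7)) (iota 0 7)) (iota 0 7)) (iota 0 7) by vm_compute.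
have in7 m : m <= 6 -> m \in iota 0 7 by rewrite mem_iota.
move=> /in7 a7 /in7 b7 /in7 c7 /in7 d7.
exact: (allP (allP (allP (h a a7) b b7) c c7) d d7).
Qed.

Lemma even_set_2222 : exists2 S, even_set B S & forall i, #|S :&: grp i| = 2.
Proof.
have [S0 ntS0] := nontrivial_set_exists GB G6.
case: (arg_minnP (fun S : {set X} => #|S|) ntS0) => S ntS minS.
have /andP[evS /existsP[k Sk]] := ntS.
(* Flipping changes the size of [S] by 12 minus twice this sum, and [S] is smallest. *)
have le i j : i != j -> #|S :&: grp i| + #|S :&: grp j| <= 6.
  move=> ij; have := minS _ (flip_nontrivial ij ntS).
  have := card_flip setT S i j; rewrite !setTI !(card_setI_grpU _ ij).
  rewrite -(setTI (grp i :|: grp j)) (card_setI_grpU _ ij) !setTI !(card_grp G6).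
  by lia.
have ev i : ~~ odd #|S :\: grp i| /\ (0 < #|S :&: grp i| -> 6 <= #|S :\: grp i|).
  split=> [|/card_gt0P[x /setIP[xS xi]]].
    have [x xi] : exists x, x \in grp i by apply/card_gt0P; rewrite (card_grp G6).
    by rewrite (even_set_sum evS xi) oddD odd_double mulnC oddM andbF.
  by rewrite (even_set_sum evS xi) xS leq_addr.
pose o k4 : 'I_4 := inord k4.
have o_neq i j : i < 4 -> j < 4 -> i != j -> o i != o j.
  by move=> i4 j4; apply: contra => /eqP/(congr1 val); rewrite /= !inordK // => ->.
have ord4 (P : 'I_4 -> Prop) : P (o 0) -> P (o 1) -> P (o 2) -> P (o 3) -> forall i, P i.
  move=> P0 P1 P2 P3 i; rewrite -[i]inord_val.
  by case: i => -[|[|[|[|//]]]] ? /=.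
pose t i := #|S :&: grp (o i)|.
have sumS : #|S| = t 0 + t 1 + t 2 + t 3.
  rewrite (card_by_grp GB G6) !big_ord_recl big_ord0 addn0 !addnA.
  by congr (#|S :&: grp _| + #|S :&: grp _| + #|S :&: grp _| + #|S :&: grp _|);
    apply: val_inj; rewrite /= inordK.
have SD i := cardsID (grp i) S.
have D0 : #|S :\: grp (o 0)| = t 1 + t 2 + t 3 by have := SD (o 0); rewrite -/(t 0); lia.
have D1 : #|S :\: grp (o 1)| = t 0 + t 2 + t 3 by have := SD (o 1); rewrite -/(t 1); lia.
have D2 : #|S :\: grp (o 2)| = t 0 + t 1 + t 3 by have := SD (o 2); rewrite -/(t 2); lia.
have D3 : #|S :\: grp (o 3)| = t 0 + t 1 + t 2 by have := SD (o 3); rewrite -/(t 3); lia.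
have [e0 f0] := ev (o 0); have [e1 f1] := ev (o 1).
have [e2 f2] := ev (o 2); have [e3 f3] := ev (o 3).
rewrite D0 in e0 f0; rewrite D1 in e1 f1; rewrite D2 in e2 f2; rewrite D3 in e3 f3.
have nt : [|| 0 < t 0 < 6, 0 < t 1 < 6, 0 < t 2 < 6 | 0 < t 3 < 6].
  by move: k Sk; apply: ord4; rewrite /t => ->; rewrite ?orbT.
have S6 i : #|S :&: grp i| <= 6 by rewrite -[6](card_grp G6 i) subset_leq_card ?subsetIr.
have := even_set_profileT (S6 (o 0)) (S6 (o 1)) (S6 (o 2)) (S6 (o 3)).
rewrite /even_set_profile !le ?o_neq // -/(t 0) -/(t 1) -/(t 2) -/(t 3) e0 e1 e2 e3 nt.
have -> : [&& (0 < t 0) ==> (6 <= t 1 + t 2 + t 3), (0 < t 1) ==> (6 <= t 0 + t 2 + t 3),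
    (0 < t 2) ==> (6 <= t 0 + t 1 + t 3) & (0 < t 3) ==> (6 <= t 0 + t 1 + t 2)].
  by apply/and4P; split; apply/implyP.
rewrite !implyTb.
case/or4P => [/and4P[/eqP s0 /eqP s1 /eqP s2 /eqP s3]|||/orP[]];
  first by exists S => //; apply: ord4.
- case/and4P => /eqP s0 /eqP s1 /eqP s2 /eqP s3; case: (@even_set_not4222 S (o 0) (o 1)) => //.
  + by rewrite D0 s1 s2 s3.
  + by rewrite D1 s0 s2 s3.
  + by rewrite -/(t 1) s1.
- case/and4P => /eqP s0 /eqP s1 /eqP s2 /eqP s3; case: (@even_set_not4222 S (o 1) (o 0)) => //.
  + by rewrite D1 s0 s2 s3.
  + by rewrite D0 s1 s2 s3.
  + by rewrite -/(t 0) s0.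
- case/and4P => /eqP s0 /eqP s1 /eqP s2 /eqP s3; case: (@even_set_not4222 S (o 2) (o 0)) => //.
  + by rewrite D2 s0 s1 s3.
  + by rewrite D0 s1 s2 s3.
  + by rewrite -/(t 0) s0.
case/and4P => /eqP s0 /eqP s1 /eqP s2 /eqP s3; case: (@even_set_not4222 S (o 3) (o 0)) => //.
+ by rewrite D3 s0 s1 s2.
+ by rewrite D0 s1 s2 s3.
+ by rewrite -/(t 0) s0.
Qed.

End Stinson.

(* The points 6i, ..., 6i + 5 form the i-th group; the first two of them belong
   to the even set, and the others are named by the blocks in collinear_6x4. *)
Definition special_6x4 : seq nat := [:: 0; 1; 6; 7; 12; 13; 18; 19].

(** Blocks joining two special points. With groups numbered from 0, those between groups 2 and 3
    name the four other points of groups 0 and 1 at once; those between 1 and 3 name points of group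
    2, and those between 1 and 2 points of group 3. *)
Definition collinear_6x4 : seq (seq nat) := [::
  [:: 12; 18; 2; 8]; [:: 12; 19; 3; 9]; [:: 13; 18; 4; 10]; [:: 13; 19; 5; 11];
  [:: 6; 18; 14]; [:: 6; 19; 15]; [:: 7; 18; 16]; [:: 7; 19; 17];
  [:: 6; 12; 20]; [:: 6; 13; 21]; [:: 7; 12; 22]; [:: 7; 13; 23]].

Definition ok_6x4 (o : bitseq) : bool :=
  [&& all (fun i => at_most_one (iota (6 * i) 6) o) (iota 0 4),
      count (nth false o) special_6x4 \in [:: 0; 2] &
      all (fun I => collinear_rule I o) collinear_6x4].

Definition cross_6x4 : seq (nat * nat) :=
  [seq p <- [seq (i, j) | i <- iota 0 24, j <- iota 0 24] | p.1 %/ 6 < p.2 %/ 6].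

(** A design has 36 blocks, and fuel 37 exceeds the depth of the search. *)
Lemma refute_6x4 : refute 37 cross_6x4 [seq o <- weight_bitseqs 24 4 | ok_6x4 o].
Proof. by vm_compute. Qed.

(** * Numbering the points by means of the even set *)

Section SpecialPoints.

Variables (X : finType) (G B : {set {set X}}).
Hypotheses (GB : is_gdd 4 G B) (G6 : perm_eq (group_sizes G) (nseq 4 6)).
Variable S : {set X}.
Hypotheses (evS : even_set B S) (S2 : forall i, #|S :&: grp G i| = 2).
Variable x0 : X.

Local Notation grp := (grp G).

Let S8 : #|S| = 8.
Proof.
rewrite (card_by_grp GB G6); transitivity (\sum_(j < 4) 2); first exact: eq_bigr.
by rewrite sum_nat_const card_ord.
Qed.

Let SD6 i : #|S :\: grp i| = 6.
Proof.
by have := cardsID (grp i) S; rewrite S2 S8 => -[].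
Qed.

Let meet2 b x : b \in B -> x \in b -> x \in S -> #|b :&: S| = 2.
Proof.
move=> bB xb xS; have [i xi] := grp_cover GB G6 x.
exact: (even_set_meet2 GB G6 evS (SD6 i) xS xi).
Qed.

Let meet3 b x y z : b \in B -> x \in b :&: S -> y \in b :&: S -> z \in b :&: S ->
  x != y -> z = x \/ z = y.
Proof.
move=> bB xbS ybS zbS xy; have /setIP[xb xS] := xbS.
have := meet2 bB xb xS; rewrite (cardsD1 x) xbS => -[] /eqP/cards1P[w wE].
have : y \in [set w] by rewrite -wE !inE eq_sym xy; move: ybS; rewrite inE.
rewrite inE => /eqP yw; have [->|zx] := eqVneq z x; [by left | right].
by apply/eqP; rewrite yw -in_set1 -wE in_setD1 zx.
Qed.

Variable sp : 'I_4 -> bool -> X.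
Hypothesis spP : forall i, sp i false != sp i true /\ S :&: grp i = [set sp i false; sp i true].

Let sp_in i a : (sp i a \in S) && (sp i a \in grp i).
Proof.
have [_ e] := spP i; rewrite -in_setI e !inE.
by case: a; rewrite eqxx ?orbT.
Qed.

Let spS i a : sp i a \in S. Proof. by have /andP[] := sp_in i a. Qed.
Let spg i a : sp i a \in grp i. Proof. by have /andP[] := sp_in i a. Qed.

Let sp_cases i a c x : a != c -> x \in S -> x \in grp i -> x = sp i a \/ x = sp i c.
Proof.
move=> ac xS xi; have [_ e] := spP i.
have : x \in S :&: grp i by rewrite inE xS.
by rewrite e !inE; case: a c ac => [] [] // _ /orP[] /eqP ->; auto.
Qed.

Let sp_inj i : injective (sp i).
Proof. by have [/eqP ne _] := spP i; case=> [] [] // e; case: ne. Qed.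

Let join x y := odflt set0 [pick b in B | (x \in b) && (y \in b)].

Let joinP i j x y : i != j -> x \in grp i -> y \in grp j ->
  [/\ join x y \in B, x \in join x y & y \in join x y].
Proof.
move=> ij xi yj; have [b bB xyb] := grp_joined GB G6 ij xi yj.
rewrite /join; case: pickP => [c /= /and3P[] //|/(_ b)].
by rewrite bB xyb.
Qed.

Let point k b := odflt x0 [pick x in b :&: grp k].

Let pointP k b : b \in B -> (point k b \in b) && (point k b \in grp k).
Proof.
move=> bB; have [x xP] := block_point GB G6 k bB.
rewrite /point; case: pickP => [y /=|/(_ x)]; first by rewrite inE.
by rewrite inE xP.
Qed.

(** The point of group [k] named by the pair of booleans [a], [c]: it lies on the block through the
    special points they designate in groups [i] and [j]. *)
Let third k i j a c := point k (join (sp i a) (sp j c)).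

Let thirdP k i j a c : i != j ->
  [/\ join (sp i a) (sp j c) \in B, sp i a \in join (sp i a) (sp j c),
      sp j c \in join (sp i a) (sp j c), third k i j a c \in join (sp i a) (sp j c)
    & third k i j a c \in grp k].
Proof.
move=> ij; have [bB ab cb] := joinP ij (spg i a) (spg j c).
by have /andP[] := pointP k bB; split.
Qed.

Let grp_neq i j x y : i != j -> x \in grp i -> y \in grp j -> x != y.
Proof.
by move=> ij xi yj; apply: contraNneq ij => e; rewrite e in xi; rewrite (grp_eq GB G6 xi yj).
Qed.

(** The block already contains two points of [S], in groups [i] and [j], and can have no third. *)
Let third_notS k i j a c : uniq [:: k; i; j] -> third k i j a c \notin S.
Proof.
rewrite /= !inE negb_or => /and3P[/andP[ki kj] ij _].
have [bB ab cb tb tk] := thirdP k a c ij; apply/negP => tS.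
have inbS x : x \in join (sp i a) (sp j c) -> x \in S -> x \in join (sp i a) (sp j c) :&: S.
  by rewrite inE => -> ->.
have ac := grp_neq ij (spg i a) (spg j c).
have [e|e] := meet3 bB (inbS _ ab (spS _ _)) (inbS _ cb (spS _ _)) (inbS _ tb tS) ac.
  by have := grp_neq ki tk (spg i a); rewrite e eqxx.
by have := grp_neq kj tk (spg j c); rewrite e eqxx.
Qed.

(* Two distinct such blocks through a point z would contain all of S in the
   groups i and j, so that the block joining z to a point of S in the fourth
   group h could not contain a second point of S, as it must. *)
Let third_inj k i j h a c a' c' : uniq [:: k; i; j; h] ->
  third k i j a c = third k i j a' c' -> (a, c) = (a', c').
Proof.
move=> u; have /andP[] : uniq ([:: k; i; j] ++ [:: h]) && true by rewrite andbT.
rewrite cat_uniq => /and3P[u3 _ _] _; move: u; rewrite /= !inE !negb_or.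
case/and4P=> /and3P[ki kj kh] /andP[ij ih] jh _ e.
have [bB ab cb tb tk] := thirdP k a c ij; have [dB ad cd td _] := thirdP k a' c' ij.
have zS := third_notS a c u3.
rewrite -e in td; set z := third k i j a c in tb tk td zS.
set b := join (sp i a) (sp j c) in bB ab cb tb.
set d := join (sp i a') (sp j c') in dB ad cd td.
have zi l s : l != k -> z != sp l s by move=> lk; rewrite eq_sym (grp_neq lk (spg l s) tk).
have [bd|bd] := eqVneq b d.
  rewrite -bd in ad cd.
  have /sp_inj -> : sp i a = sp i a' by apply: (grp_block_eq GB G6 bB ab ad (spg i a)).
  by have /sp_inj -> : sp j c = sp j c' by apply: (grp_block_eq GB G6 bB cb cd (spg j c)).
have aa' : a != a'.
  apply: contraNneq bd => aa'; rewrite -aa' in ad; rewrite eq_sym in ki; apply/eqP.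
  exact: (gdd_block_eq GB bB dB (zi i a ki)).
have cc' : c != c'.
  apply: contraNneq bd => cc'; rewrite -cc' in cd; rewrite eq_sym in kj; apply/eqP.
  exact: (gdd_block_eq GB bB dB (zi j c kj)).
have [fB zf yf] := joinP kh tk (spg h false); set f := join _ _ in fB zf yf.
have [q /setIP[qf qS] qy] : exists2 q, q \in f :&: S & q != sp h false.
  have := meet2 fB yf (spS h false); rewrite (cardsD1 (sp h false)) inE yf spS => -[].
  by move/eqP/cards1P => [q qE]; have := set11 q; rewrite -qE in_setD1 => /andP[]; exists q.
have [l ql] := grp_cover GB G6 q.
(* A block through [z] and [q] is [f], so it would also contain [sp h false], a third point of
   [S]. *)
have bad g s t : g \in B -> sp i s \in g -> sp j t \in g -> z \in g -> q \in g -> False.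
  move=> gB sg tg zg qg; have zq : z != q by apply: contraNneq zS => ->.
  have ge := gdd_block_eq GB gB fB zq zg qg zf qf; rewrite -{}ge in yf.
  have inS x : x \in g -> x \in S -> x \in g :&: S by rewrite inE => -> ->.
  have [e1|e1] := meet3 gB (inS _ sg (spS _ _)) (inS _ tg (spS _ _)) (inS _ yf (spS _ _))
    (grp_neq ij (spg i s) (spg j t)).
    by have := grp_neq ih (spg i s) (spg h false); rewrite e1 eqxx.
  by have := grp_neq jh (spg j t) (spg h false); rewrite e1 eqxx.
(* The group of [q] is none of the four. In [k] and [h] the block [f] already has the points [z] and
   [sp h false]; in [i] and [j] both points of [S] are on [b] or [d], against [bad]. *)
have : l \in [:: k; i; j; h].
  have u4 : uniq [:: k; i; j; h] by rewrite /= !inE !negb_or ki kj kh ij ih jh.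
  suff -> : [:: k; i; j; h] =i 'I_4 by [].
  by apply/subset_cardP; [rewrite (card_uniqP u4) card_ord | apply/subsetP].
rewrite !inE => /or4P[] /eqP lE; rewrite lE in ql.
- by move: zS; rewrite (grp_block_eq GB G6 fB zf qf tk ql) qS.
- have [qE|qE] := sp_cases aa' qS ql.
    by case: (bad b a c) => //; rewrite qE.
  by case: (bad d a' c') => //; rewrite qE.
- have [qE|qE] := sp_cases cc' qS ql.
    by case: (bad b a c) => //; rewrite qE.
  by case: (bad d a' c') => //; rewrite qE.
by move: qy; rewrite (grp_block_eq GB G6 fB qf yf ql (spg h false)) eqxx.
Qed.

(** The points of group [k], in the order in which [collinear_6x4] numbers them. *)
Let row k i j : seq X := [:: sp k false; sp k true; third k i j false false;
  third k i j false true; third k i j true false; third k i j true true].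

Let row_uniq k i j h : uniq [:: k; i; j; h] -> uniq (row k i j).
Proof.
move=> u; have u3 : uniq [:: k; i; j].
  by move: u; rewrite -[[:: k; i; j; h]]/([:: k; i; j] ++ [:: h]) cat_uniq => /andP[].
have -> : row k i j = [seq sp k a | a <- [:: false; true]] ++
    [seq third k i j l.1 l.2
      | l <- [:: (false, false); (false, true); (true, false); (true, true)]] by [].
rewrite cat_uniq !map_inj_uniq; last exact: sp_inj; last first.
  by move=> [a c] [a' c'] /(third_inj u).
apply/and3P; split=> //; apply/hasPn => x /mapP[l _ ->].
by apply/negP => /mapP[a _ e]; have := third_notS l.1 l.2 u3; rewrite e spS.
Qed.

Let row_grp k i j : i != j -> {in row k i j, forall x, x \in grp k}.
Proof.
move=> ij x; have t a c : third k i j a c \in grp k by have [] := thirdP k a c ij.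
by rewrite !inE => /or4P[|||/or3P[]] /eqP ->; rewrite ?spg ?t.
Qed.

Let o m : 'I_4 := inord m.

Let o_uniq l : all (gtn 4) l -> uniq l -> uniq [seq o m | m <- l].
Proof.
move=> /allP l4 u; rewrite map_inj_in_uniq // => i j /l4 i4 /l4 j4 /(congr1 val).
by rewrite /= !inordK.
Qed.

Let o_neq i j : i < 4 -> j < 4 -> i != j -> o i != o j.
Proof.
by move=> i4 j4; apply: contra => /eqP/(congr1 val); rewrite /= !inordK // => ->.
Qed.

Let pts := row (o 0) (o 2) (o 3) ++ row (o 1) (o 2) (o 3) ++
           row (o 2) (o 1) (o 3) ++ row (o 3) (o 1) (o 2).

Let pts_uniq : uniq pts.
Proof.
have d k l i j i' j' : k < 4 -> l < 4 -> k != l -> i != j -> i' != j' ->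
    ~~ has (mem (row (o k) i j)) (row (o l) i' j').
  move=> k4 l4 kl ij ij'; apply/hasPn => x /(row_grp ij') xl; apply/negP => /(row_grp ij) xk.
  by have := o_neq k4 l4 kl; rewrite (grp_eq GB G6 xk xl) eqxx.
have u0 := row_uniq (o_uniq (l := [:: 0; 2; 3; 1]) isT isT).
have u1 := row_uniq (o_uniq (l := [:: 1; 2; 3; 0]) isT isT).
have u2 := row_uniq (o_uniq (l := [:: 2; 1; 3; 0]) isT isT).
have u3 := row_uniq (o_uniq (l := [:: 3; 1; 2; 0]) isT isT).
have nh (P : pred X) s t : ~~ has P s -> ~~ has P t -> ~~ has P (s ++ t).
  by rewrite has_cat negb_or => -> ->.
have cu (s t : seq X) : uniq s -> ~~ has (mem s) t -> uniq t -> uniq (s ++ t).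
  by rewrite cat_uniq => -> -> ->.
apply: cu u0 (nh _ _ _ _ (nh _ _ _ _ _)) (cu _ _ u1 (nh _ _ _ _ _) (cu _ _ u2 _ u3));
  exact: d (o_neq _ _ _) (o_neq _ _ _).
Qed.

Let pts_size : size pts = #|X|.
Proof. by rewrite (card_points GB G6). Qed.

Let pts_grp m : m < 24 -> nth x0 pts m \in grp (o (m %/ 6)).
Proof.
have r k i j l : l < 6 -> i != j -> nth x0 (row k i j) l \in grp k.
  by move=> l6 ij; apply: (row_grp ij); apply: mem_nth.
move=> m24; rewrite /pts !nth_cat -![size (row _ _ _)]/6.
case: ltnP => m6; first by rewrite divn_small // r ?o_neq.
case: ltnP => m12; first by rewrite (_ : m %/ 6 = 1) ?r ?o_neq //; lia.
case: ltnP => m18; first by rewrite (_ : m %/ 6 = 2) ?r ?o_neq //; lia.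
by rewrite (_ : m %/ 6 = 3) ?r ?o_neq //; lia.
Qed.

Let collinear_pts I : I \in collinear_6x4 ->
  exists2 c, c \in B & {in I, forall i, nth x0 pts i \in c}.
Proof.
have ex i j a c I' : i < 4 -> j < 4 -> i != j ->
    all (fun m => nth x0 pts m \in join (sp (o i) a) (sp (o j) c)) I' ->
    exists2 c, c \in B & {in I', forall i, nth x0 pts i \in c}.
  move=> i4 j4 ij /allP Ic; exists (join (sp (o i) a) (sp (o j) c)) => //.
  by have [] := thirdP (o 0) a c (o_neq i4 j4 ij).
(* The trailing [true] gives the statement the form to which [all] over a list of the table unfolds,
   so that evaluating [nth] on [pts] identifies the two. *)
have c23 a c : [&& sp (o 2) a \in join (sp (o 2) a) (sp (o 3) c),
    sp (o 3) c \in join (sp (o 2) a) (sp (o 3) c),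
    third (o 0) (o 2) (o 3) a c \in join (sp (o 2) a) (sp (o 3) c),
    third (o 1) (o 2) (o 3) a c \in join (sp (o 2) a) (sp (o 3) c) & true].
  have ij := o_neq (i := 2) (j := 3) isT isT isT.
  have [_ -> -> -> _] := thirdP (o 0) a c ij.
  by have [_ _ _ -> _] := thirdP (o 1) a c ij.
have c13 a c : [&& sp (o 1) a \in join (sp (o 1) a) (sp (o 3) c),
    sp (o 3) c \in join (sp (o 1) a) (sp (o 3) c),
    third (o 2) (o 1) (o 3) a c \in join (sp (o 1) a) (sp (o 3) c) & true].
  have ij := o_neq (i := 1) (j := 3) isT isT isT.
  by have [_ -> -> -> _] := thirdP (o 2) a c ij.
have c12 a c : [&& sp (o 1) a \in join (sp (o 1) a) (sp (o 2) c),
    sp (o 2) c \in join (sp (o 1) a) (sp (o 2) c),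
    third (o 3) (o 1) (o 2) a c \in join (sp (o 1) a) (sp (o 2) c) & true].
  have ij := o_neq (i := 1) (j := 2) isT isT isT.
  by have [_ -> -> -> _] := thirdP (o 3) a c ij.
rewrite !inE => /or4P[|||/or4P[|||/or4P[|||/or3P[]]]] /eqP ->.
- by apply: (ex 2 3 false false) => //; apply: c23 false false.
- by apply: (ex 2 3 false true) => //; apply: c23 false true.
- by apply: (ex 2 3 true false) => //; apply: c23 true false.
- by apply: (ex 2 3 true true) => //; apply: c23 true true.
- by apply: (ex 1 3 false false) => //; apply: c13 false false.
- by apply: (ex 1 3 false true) => //; apply: c13 false true.
- by apply: (ex 1 3 true false) => //; apply: c13 true false.
- by apply: (ex 1 3 true true) => //; apply: c13 true true.
- by apply: (ex 1 2 false false) => //; apply: c12 false false.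
- by apply: (ex 1 2 false true) => //; apply: c12 false true.
- by apply: (ex 1 2 true false) => //; apply: c12 true false.
- by apply: (ex 1 2 true true) => //; apply: c12 true true.
Qed.

Lemma no_gdd_special : False.
Proof.
apply: (@refute_gdd _ _ _ x0 pts GB pts_uniq pts_size 37 cross_6x4 ok_6x4).
- move=> b bB; rewrite /ok_6x4; apply/and3P; split.
  + apply/allP => i; rewrite mem_iota /= => i4.
    apply: (@at_most_one_bits _ _ _ x0 _ GB pts_uniq pts_size b (grp (o i))
      (iota (6 * i) 6) bB (grp_mem G6 (o i))).
    * by rewrite (card_points GB G6); apply/allP => j; rewrite mem_iota => /andP[_ ji] /=; lia.
    * exact: iota_uniq.
    move=> j; rewrite mem_iota => /andP[ij ji].
    have <- : j %/ 6 = i by lia.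
    by apply: pts_grp; lia.
  + have IX : all (gtn #|X|) special_6x4 by rewrite (card_points GB G6).
    rewrite (count_bits x0 pts_size) //; set L := [seq _ | _ <- _].
    have Lu : uniq L.
      rewrite map_inj_in_uniq // => i j iI jI /eqP.
      by have [iX jX] := (allP IX i iI, allP IX j jI); rewrite nth_uniq ?pts_size // => /eqP.
    have LS : L =i S.
      apply/subset_cardP; first by rewrite (card_uniqP Lu) S8.
      by apply/subsetP => x; rewrite !inE => /or4P[|||/or4P[|||/orP[]]] /eqP ->; apply: spS.
    have -> : count (mem b) L = #|b :&: S|.
      rewrite -size_filter -(card_uniqP (filter_uniq _ Lu)).
      by apply: eq_card => x; rewrite [RHS]inE -LS; apply: mem_filter.
    have [/eqP->//|/set0Pn[x /setIP[xb xS]]] := boolP (b :&: S == set0).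
      by rewrite cards0.
    by rewrite (meet2 bB xb xS).
  apply/allP => I II; have [c cB Ic] := collinear_pts II.
  apply: (collinear_rule_bits (x0 := x0) GB pts_uniq pts_size bB cB) => //.
  + rewrite (card_points GB G6).
    by apply: (@allP _ (fun I => all (gtn 24) I) collinear_6x4 _ I II).
  + by apply: (@allP _ (fun I => uniq I) collinear_6x4 _ I II).
- apply/allP => -[i j]; rewrite mem_filter => /andP[ij /allpairsP[[i' j'] [i24 j24 [iE jE]]]].
  move: i24 j24; rewrite !mem_iota -iE -jE => /= i24 j24.
  rewrite /= in ij; rewrite (card_points GB G6) i24 j24 /=.
  rewrite (gdd_def_pblock GB (grp_mem G6 _) (pts_grp i24)).
  rewrite (gdd_def_pblock GB (grp_mem G6 _) (pts_grp j24)).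
  apply: contraTneq ij => /(grp_inj G6)/(congr1 val).
  by rewrite /= !inordK; lia.
by rewrite (card_points GB G6); apply: refute_6x4.
Qed.

End SpecialPoints.

Lemma no_gdd_6x4 (X : finType) (G B : {set {set X}}) : is_gdd 4 G B ->
  perm_eq (group_sizes G) (nseq 4 6) -> False.
Proof.
move=> GB G6; have [S evS S2] := even_set_2222 GB G6.
have /fin_all_exists[sp spP] : forall i : 'I_4, exists f : bool -> X,
    f false != f true /\ S :&: grp G i = [set f false; f true].
  move=> i; have /eqP/cards2P[u [w [uw E]]] := S2 i.
  by exists (fun a => if a then w else u).
exact: (no_gdd_special GB G6 evS S2 (sp ord0 false) spP).
Qed.

Theorem theorem2p2 :
  (forall s : seq nat,
     (feasible_4gdd_type s /\ sumn s <= 30) <-> s \in listed_types) /\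
  (forall s : seq nat,
     s \in listed_types -> s \notin exceptional_types -> gdd_exists 4 s) /\
  (forall s : seq nat, s \in exceptional_types -> ~ gdd_exists 4 s).
Proof.
split; [exact: feasible_listed | split; first exact: listed_gdd_exists].
(* Evaluating the exponential notation turns the exceptional types into these nonincreasing
   sequences. *)
move=> s; rewrite -[exceptional_types]/[:: nseq 4 2; 5 :: nseq 6 2; nseq 4 6] !inE.
by case/or3P => /eqP -> [X [G [B [GB Gs]]]];
  [apply: (no_gdd_2x4 GB Gs) | apply: (no_gdd_2x6_5x1 GB Gs) | apply: (no_gdd_6x4 GB Gs)].
Qed.
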